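(* Let $\phi(\xi_1,\xi_2)=\xi_1\xi_2$ and let $\mathbb{H}=\{(\xi_1,\xi_2,\xi_1\xi_2):\xi_1,\xi_2\in[0,1]\}$ be the truncated hyperbolic paraboloid. Suppose that the following decoupling inequality holds: for every $2\le p\le4$ and every $\epsilon>0$ there is $C_\epsilon$ such that for every $0<\delta<1$ with $\delta^{-1}$ dyadic and every $f:\mathbb{R}^3\to\mathbb{C}$ with Fourier support in $N_\delta(\mathbb{H})$, $$\|f\|_{L^p(\mathbb{R}^3)}\le C_\epsilon\,\delta^{-\epsilon}\Big(\sum_{m=-\frac12\log\delta^{-1}}^{\frac12\log\delta^{-1}}\ \sum_{S\in\mathcal{R}_{2^m\delta^{1/2},\,2^{-m}\delta^{1/2},\,0}}\|f_S\|_{L^p(\mathbb{R}^3)}^2\Big)^{1/2}.$$ Then the Stein--Tomas estimate holds up to a $\delta^{-\epsilon}$ loss: for every $4\le p\le\infty$ and every $\epsilon>0$ there is a constant $C'_\epsilon$ such that $$\|\widehat F\|_{L^p(B_{\delta^{-1}})}\le C'_\epsilon\,\delta^{-\epsilon}\,\delta^{1/2}\,\|F\|_{L^2(N_\delta(\mathbb{H}))}$$ for each $0<\delta<1$, each ball $B_{\delta^{-1}}\subset\mathbb{R}^3$ of radius $\delta^{-1}$, and each $F\in L^2(N_\delta(\mathbb{H}))$ supported in $N_\delta(\mathbb{H})$.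
   Context: $N_\delta(\mathbb{H})$ is the $\delta$-neighborhood of $\mathbb{H}$ in $\mathbb{R}^3$. The logarithm is base $2$ and $m$ ranges over integers. $\mathcal{R}_{a,b,0}$ denotes a collection of translated copies of the axis-parallel rectangle of dimensions $a\times b$ (side $a$ in the $\xi_1$ direction, side $b$ in the $\xi_2$ direction), which are disjoint and whose union contains $[0,1]^2$. With each family $\mathcal{R}=\mathcal{R}_{a,b,0}$ is associated a family of smooth functions $\{\Xi_R\}_{R\in\mathcal{R}}$ on $\mathbb{R}^2$ such that: (i) $\widehat{\Xi_R}$ is supported in $2R$ (dilate of $R$ by factor 2 about its center); (ii) $0\le\widehat{\Xi_R}\le1$; (iii) $\widehat{\Xi_R}>1/10$ on $R$; (iv) $\sum_{R\in\mathcal{R}}\widehat{\Xi_R}(\xi)=1$ for $\xi\in[0,1]^2$; (v) $\|\Xi_R\|_{L^1}\le1000$. Then $f_R(x_1,x_2,x_3):=\int_{\mathbb{R}^2}f(x_1-y_1,x_2-y_2,x_3)\,\Xi_R(y_1,y_2)\,dy_1dy_2$. *)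

(* Defs.v *)
From HB Require Import structures.
From mathcomp Require Import all_boot all_order all_algebra.
From mathcomp Require Import complex.
From mathcomp Require Import all_classical all_reals all_analysis.

Set Implicit Arguments.
Unset Strict Implicit.
Unset Printing Implicit Defensive.

Import Order.TTheory GRing.Theory Num.Theory.
Import numFieldNormedType.Exports.

Local Open Scope classical_set_scope.
Local Open Scope ring_scope.

Section ComplexFunctions.
Context {R : realType}.

Definition cmod (z : R[i]) : R := ComplexField.Normc.normc z.

(* exp (i t) *)
Definition expi (t : R) : R[i] := (cos t +i* sin t)%C.

Context {d : measure_display} {T : measurableType d}.
Variable mu : {measure set T -> \bar R}.
Implicit Type f : T -> R[i].

Definition cmeasurable f : Prop :=
  measurable_fun setT (fun x => complex.Re (f x)) /\
  measurable_fun setT (fun x => complex.Im (f x)).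

Definition cintegrable f : Prop :=
  mu.-integrable setT (fun x => (complex.Re (f x))%:E) /\
  mu.-integrable setT (fun x => (complex.Im (f x))%:E).

Definition cintegral f : R[i] :=
  ((\int[mu]_x complex.Re (f x)) +i* (\int[mu]_x complex.Im (f x)))%C.

Definition cLnorm (p : \bar R) (A : set T) f : \bar R :=
  ('N[mu]_p[ (fun x => (cmod (f x))%:E) \_ A ])%E.

Definition cLp (p : \bar R) (A : set T) f : Prop :=
  cmeasurable f /\ (cLnorm p A f < +oo)%E.

End ComplexFunctions.

Section LebesgueMeasures.

(* The library declares a sigma-finite instance for products, but it is not
   found by unification; it is needed to iterate products and for Fubini. *)
Lemma product_sigma_finite d1 d2 (T1 : measurableType d1)
    (T2 : measurableType d2) (R : realType)
    (m1 : {sigma_finite_measure set T1 -> \bar R})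
    (m2 : {sigma_finite_measure set T2 -> \bar R}) :
  sigma_finite setT (m1 \x m2)%E.
Proof.
have /sigma_finiteP[F [TF ndF Foo]] := sigma_finiteT m1.
have /sigma_finiteP[G [TG ndG Goo]] := sigma_finiteT m2.
exists (fun n => F n `*` G n) => [|k].
  rewrite -setXTT TF TG predeqE => -[x y]; split.
    move=> [/= [n _ Fnx] [k _ Gky]]; exists (maxn n k) => //; split.
    - by move: x Fnx; exact/subsetPset/ndF/leq_maxl.
    - by move: y Gky; exact/subsetPset/ndG/leq_maxr.
  by move=> [n _ [/= ? ?]]; split; exists n.
have [? ?] := Foo k; have [? ?] := Goo k; split; first exact: measurableX.
by rewrite product_measure1E// lte_mul_pinfty// ge0_fin_numE.
Qed.

Variable R : realType.
Let mR := measurableTypeR R.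

Definition leb2 : set (mR * mR) -> \bar R :=
  (@lebesgue_measure R \x @lebesgue_measure R)%E.

HB.instance Definition _ := Measure.on leb2.
HB.instance Definition _ := Measure_isSigmaFinite.Build _ _ _ leb2
  (product_sigma_finite (@lebesgue_measure R) (@lebesgue_measure R)).

Definition leb3 : set (mR * mR * mR) -> \bar R :=
  (leb2 \x @lebesgue_measure R)%E.

HB.instance Definition _ := Measure.on leb3.
HB.instance Definition _ := Measure_isSigmaFinite.Build _ _ _ leb3
  (product_sigma_finite leb2 (@lebesgue_measure R)).

End LebesgueMeasures.

Arguments leb2 : clear implicits.
Arguments leb3 : clear implicits.

Section Euclidean.
Variable R : realType.

Definition dot2 (x y : R * R) : R := x.1 * y.1 + x.2 * y.2.
Definition dot3 (x y : R * R * R) : R := dot2 x.1 y.1 + x.2 * y.2.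

(* The library norm on a product is the sup norm, hence this one. *)
Definition norm3 (x : R * R * R) : R := Num.sqrt (dot3 x x).

Definition ball3 (c : R * R * R) (r : R) : set (R * R * R) :=
  [set x | norm3 (x - c) < r].

Definition nbhd3 (delta : R) (A : set (R * R * R)) : set (R * R * R) :=
  [set x | exists2 y, A y & norm3 (x - y) < delta].

Definition fourier2 (f : R * R -> R[i]) (xi : R * R) : R[i] :=
  cintegral (leb2 R) (fun x => f x * expi (- (2 * pi * dot2 x xi))).

Definition fourier3 (f : R * R * R -> R[i]) (xi : R * R * R) : R[i] :=
  cintegral (leb3 R) (fun x => f x * expi (- (2 * pi * dot3 x xi))).

(* C^n: all iterated directional derivatives up to order n exist everywhere
   and are continuous. *)
Fixpoint Cn (n : nat) (f : R * R -> R) : Prop :=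
  continuous f /\
  if n is n'.+1 then
    forall v, (forall x, derivable f x v) /\ Cn n' (fun x => 'D_v f x)
  else True.

Definition smooth2 (f : R * R -> R[i]) : Prop :=
  forall n, Cn n (fun x => complex.Re (f x)) /\
            Cn n (fun x => complex.Im (f x)).

Definition log2 (x : R) : R := ln x / ln 2.

Definition dyadic (x : R) : Prop := exists k : nat, x = 2 ^+ k.

End Euclidean.

Section Decoupling.
Variable R : realType.

Definition phi (xi : R * R) : R := xi.1 * xi.2.

Definition unit_square : set (R * R) := `[0, 1] `*` `[0, 1].

Definition hyp_paraboloid : set (R * R * R) :=
  [set (xi, phi xi) | xi in unit_square].

(* The a x b rectangle centred at c.  It is half-open, so that disjoint
   translates can cover a square. *)
Definition rect (a b : R) (c : R * R) : set (R * R) :=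
  `[c.1 - a / 2, c.1 + a / 2[ `*` `[c.2 - b / 2, c.2 + b / 2[.

(* A collection of translates of the a x b rectangle is given by the set D of
   their centres, and a family indexed by the collection by a function of the
   centre; rect (2 * a) (2 * b) c is the dilate by 2 of rect a b c. *)
Record rect_collection (a b : R) (D : set (R * R)) : Prop := {
  rect_disjoint : trivIset D (rect a b) ;
  rect_cover : unit_square `<=` \bigcup_(c in D) rect a b c }.

(* The inequalities in Xi_ge0_le1 and Xi_lower are in the order of R[i], for
   which comparable numbers have the same imaginary part; they make the
   transforms real-valued, so Xi_sum1 loses nothing by taking real parts. *)
Record partition_family (a b : R) (D : set (R * R))
    (Xi : R * R -> R * R -> R[i]) : Prop := {
  Xi_smooth : forall c, D c -> smooth2 (Xi c) ;
  Xi_supp : forall c, D c ->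
    closure [set xi | fourier2 (Xi c) xi != 0]
      `<=` closure (rect (2 * a) (2 * b) c) ;
  Xi_ge0_le1 : forall c, D c -> forall xi, 0 <= fourier2 (Xi c) xi <= 1 ;
  Xi_lower : forall c, D c -> forall xi, rect a b c xi ->
    10^-1 < fourier2 (Xi c) xi ;
  Xi_sum1 : forall xi, unit_square xi ->
    (\esum_(c in D) (complex.Re (fourier2 (Xi c) xi))%:E = 1)%E ;
  Xi_L1 : forall c, D c -> (cLnorm (leb2 R) 1 setT (Xi c) <= 1000%:E)%E }.

(* f_R for R the rectangle with kernel K. *)
Definition piece (K : R * R -> R[i]) (f : R * R * R -> R[i])
    (x : R * R * R) : R[i] :=
  cintegral (leb2 R)
    (fun y => f (x.1.1 - y.1, x.1.2 - y.2, x.2) * K y).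

(* Integrability of f makes its Fourier transform a continuous function given
   by the integral. *)
Definition fourier_supported (f : R * R * R -> R[i]) (A : set (R * R * R)) :
    Prop :=
  cintegrable (leb3 R) f /\ closure [set xi | fourier3 f xi != 0] `<=` A.

Definition scales (delta : R) : set int :=
  [set m : int | - (2^-1 * log2 delta^-1) <= m%:~R <= 2^-1 * log2 delta^-1].

Definition decoupling_rhs (Rc : R -> R -> set (R * R))
    (Xi : R -> R -> R * R -> R * R -> R[i])
    (p delta : R) (f : R * R * R -> R[i]) : \bar R :=
  ((\esum_(m in scales delta)
     let a := ((2 : R) ^ m * delta `^ (2^-1))%R in
     let b := ((2 : R) ^ (- m) * delta `^ (2^-1))%R in
     \esum_(c in Rc a b)
       cLnorm (leb3 R) p%:E setT (piece (Xi a b c) f) ^+ 2) `^ 2^-1)%E.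

Definition decoupling_inequality (Rc : R -> R -> set (R * R))
    (Xi : R -> R -> R * R -> R * R -> R[i]) : Prop :=
  forall p : R, 2 <= p <= 4 -> forall eps : R, 0 < eps ->
  exists2 C : R, 0 < C &
  forall delta : R, 0 < delta < 1 -> dyadic delta^-1 ->
  forall f : R * R * R -> R[i],
    fourier_supported f (nbhd3 delta hyp_paraboloid) ->
    (cLnorm (leb3 R) p%:E setT f
       <= (C * delta `^ (- eps))%:E * decoupling_rhs Rc Xi p delta f)%E.

Definition stein_tomas_estimate : Prop :=
  forall p : \bar R, (4%:E <= p)%E -> forall eps : R, 0 < eps ->
  exists2 C : R, 0 < C &
  forall delta : R, 0 < delta < 1 ->
  forall (c : R * R * R) (F : R * R * R -> R[i]),
    let N := nbhd3 delta hyp_paraboloid in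
    cLp (leb3 R) 2%:E N F ->
    {ae leb3 R, forall xi, ~ N xi -> F xi = 0} ->
    (cLnorm (leb3 R) p (ball3 c delta^-1) (fourier3 F)
       <= (C * delta `^ (- eps) * delta `^ (2^-1))%:E
          * cLnorm (leb3 R) 2%:E N F)%E.

End Decoupling.

(* Main.v *)
From HB Require Import structures.
Require Import Defs.
From mathcomp Require Import all_boot all_order all_algebra.
From mathcomp Require Import all_classical all_reals all_analysis.
From mathcomp Require Import complex.
From mathcomp Require Import measurable_realfun ess_sup_inf ring lra.

(** The estimate is proved at the endpoints p = oo and p = 4, up to a
    logarithm of delta at p = 4, and interpolated in between; delta^(-eps)
    absorbs the logarithm.

    The neighborhood of the surface is contained in a [tube] of measure
    O(delta). The endpoint p = oo is therefore the Cauchy-Schwarz inequality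
    ([fourier3_sup]).

    The exponent p = 4 is even, and the square of the Fourier transform of F
    is an integral of exponentials of frequency a + b against F(a) F(b) da db.
    A Bessel inequality ([bessel_inequality]) bounds its L^2 norm on any ball,
    up to a constant, by M^(1/2) times the L^2 norm of F(a) F(b), which is the
    square of that of F; here M is the supremum over s of the measure of the
    set of the a such that a and s - a both lie in the tube
    ([sumset_kernel_mass]). So everything rests on M = O(delta^2
    log(1/delta)), which is [tube_sumset]. The two conditions on a confine a3
    to an interval of length O(delta), and they imply that a1 a2 + (s1 - a1)
    (s2 - a2) is within O(delta) of s3. This expression is affine in a2, of
    slope 2 a1 - s1, so that a2 lies in a set of measure O(delta / (delta + |2
    a1 - s1|)), and integrating in a1 produces the logarithm.

    The Bessel inequality is stated for the weight exp(- l (|x1| + |x2| +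
    |x3|)), whose Fourier transform [kernel3] is a product of Poisson kernels:
    it is nonnegative and has total mass 1 whatever l is. Hence l can be
    chosen so small that the weight is bounded below on a given ball
    ([ball3_weight]). Expanding the square and exchanging the integrals turns
    the weighted L^2 norm into a quadratic form with kernel [kernel3], to
    which Schur's test applies.

    All integrals are real: the real and imaginary parts of F are treated
    separately, through their cosine and sine transforms. *)

Set Implicit Arguments.
Unset Strict Implicit.
Unset Printing Implicit Defensive.

Import Order.TTheory GRing.Theory Num.Theory.
Import numFieldNormedType.Exports.

Local Open Scope classical_set_scope.
Local Open Scope ring_scope.

Local Notation mR R := (measurableTypeR R).
Local Notation R3 R := (mR R * mR R * mR R)%type.

(** * Measurability *)

Section measurability.
Context d (T : measurableType d) {R : realType}.
Implicit Types f g : T -> R.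

Lemma measurable_addr f g : measurable_fun setT f -> measurable_fun setT g ->
  measurable_fun setT (fun x => f x + g x).
Proof. exact: measurable_funD. Qed.

Lemma measurable_mulr f g : measurable_fun setT f -> measurable_fun setT g ->
  measurable_fun setT (fun x => f x * g x).
Proof. exact: measurable_funM. Qed.

Lemma measurable_oppr f : measurable_fun setT f ->
  measurable_fun setT (fun x => - f x).
Proof. exact: measurable_funN. Qed.

Lemma measurable_expr f n : measurable_fun setT f ->
  measurable_fun setT (fun x => f x ^+ n).
Proof. exact: measurable_funX. Qed.

Lemma measurable_normr f : measurable_fun setT f ->
  measurable_fun setT (fun x => `|f x|).
Proof. exact: measurableT_comp. Qed.

Lemma measurable_continuous_comp (h : R -> R) f : continuous h ->
  measurable_fun setT f -> measurable_fun setT (fun x => h (f x)).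
Proof. move=> /continuous_measurable_fun mh mf; exact: measurableT_comp. Qed.

Lemma measurable_EFin_comp f : measurable_fun setT f ->
  measurable_fun setT (fun x => (f x)%:E).
Proof. by move=> ?; exact/measurable_EFinP. Qed.

Lemma measurable_ler_set f g : measurable_fun setT f -> measurable_fun setT g ->
  measurable [set x | f x <= g x].
Proof.
move=> mf mg; have := measurable_fun_ler mf mg => /(_ measurableT [set true]).
rewrite setTI; apply => //.
Qed.

End measurability.

Lemma measurable_fst_comp d1 d2 d (T1 : measurableType d1)
  (T2 : measurableType d2) (T : measurableType d) (f : T -> T1 * T2) :
  measurable_fun setT f -> measurable_fun setT (fun x => (f x).1).
Proof. by move=> mf; apply: measurableT_comp. Qed.

Lemma measurable_snd_comp d1 d2 d (T1 : measurableType d1)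
  (T2 : measurableType d2) (T : measurableType d) (f : T -> T1 * T2) :
  measurable_fun setT f -> measurable_fun setT (fun x => (f x).2).
Proof. by move=> mf; apply: measurableT_comp. Qed.

Lemma measurable_oppr3 d (T : measurableType d) (R : realType) (f : T -> R3 R) :
  measurable_fun setT f -> measurable_fun setT (fun x => (- f x : R3 R)).
Proof.
move=> mf; rewrite (_ : (fun _ => _) =
  fun x => (- (f x).1.1, - (f x).1.2, - (f x).2) : R3 R); last
    by apply/funext => x.
do 2 (apply: measurable_fun_pair; last by apply: measurable_oppr;
  repeat first [apply: measurable_fst_comp|apply: measurable_snd_comp]).
by apply: measurable_oppr;
  repeat first [apply: measurable_fst_comp|apply: measurable_snd_comp].
Qed.

Lemma measurable_addr3 d (T : measurableType d) (R : realType)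
  (f g : T -> R3 R) :
  measurable_fun setT f -> measurable_fun setT g ->
  measurable_fun setT (fun x => (f x + g x : R3 R)).
Proof.
move=> mf mg; rewrite (_ : (fun _ => _) =
  fun x => ((f x).1.1 + (g x).1.1, (f x).1.2 + (g x).1.2,
    (f x).2 + (g x).2) : R3 R); last first.
  by apply/funext => x.
do 2 (apply: measurable_fun_pair; last by apply: measurable_addr;
  repeat first [apply: measurable_fst_comp|apply: measurable_snd_comp]).
by apply: measurable_addr;
  repeat first [apply: measurable_fst_comp|apply: measurable_snd_comp].
Qed.

(** Follows the syntax of a function built from projections, ring operations,
    exp, cos and sin, down to functions whose measurability is in the context.
    *)
Ltac measurability := repeat first [ assumption |
  match goal with
  | |- measurable_fun _ (fun _ => ?c) => exact: measurable_cst
  | |- measurable_fun _ (fun x => x) => exact: measurable_id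
  | |- measurable_fun _ (pair _) => exact: pair1_measurable
  | |- measurable_fun _ fst => exact: measurable_fst
  | |- measurable_fun _ snd => exact: measurable_snd
  | |- measurable_fun _ (fun x => (@?f x).1) => apply: measurable_fst_comp
  | |- measurable_fun _ (fun x => (@?f x).2) => apply: measurable_snd_comp
  | |- measurable_fun _ (fun x => (@?f x, @?g x)) => apply: measurable_fun_pair
  | |- measurable_fun _ (fun x => @?f x + @?g x)%R => apply: measurable_addr
  | |- measurable_fun _ (fun x => @?f x * @?g x)%R => apply: measurable_mulr
  | |- measurable_fun _ (fun x => - @?f x)%R => apply: measurable_oppr
  | |- measurable_fun _ (fun x => @?f x + @?g x)%R => apply: measurable_addr3
  | |- measurable_fun _ (fun x => - @?f x)%R => apply: measurable_oppr3
  | |- measurable_fun _ (@GRing.opp _) =>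
    exact: (measurable_oppr3 (@measurable_id _ _ _))
  | |- measurable_fun _ (@GRing.add _ _) =>
    exact: (measurable_addr3 (@measurable_cst _ _ _ _ _ _)
    (@measurable_id _ _ _))
  | |- measurable_fun _ (fun x => (@?f x) ^+ _)%R => apply: measurable_expr
  | |- measurable_fun _ (fun x => `|@?f x|)%R => apply: measurable_normr
  | |- measurable_fun _ (fun x => expR (@?f x))%R =>
    apply: (measurable_continuous_comp (@continuous_expR _))
  | |- measurable_fun _ (fun x => cos (@?f x))%R =>
    apply: (measurable_continuous_comp (@continuous_cos _))
  | |- measurable_fun _ (fun x => sin (@?f x))%R =>
    apply: (measurable_continuous_comp (@continuous_sin _))
  | |- measurable_fun _ (fun x => (@?f x)%:E) => apply: measurable_EFin_comp
  | |- measurable_fun _ (fun x => @?f x * @?g x)%E => apply: emeasurable_funM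
  | |- measurable_fun _ (fun x => ?f (@?g x)) =>
    apply: (measurableT_comp (f := f)); first assumption
  end | by [] ].

(** * Lebesgue integrals on the line and in space *)

Section basic.
Context {R : realType}.
Local Notation leb := (@lebesgue_measure R).
Local Open Scope ereal_scope.

Lemma lebesgue_measure_translation (c : R) (A : set (mR R)) : measurable A ->
  pushforward leb (fun x : mR R => (x + c)%R : mR R) A = leb A.
Proof.
have mc : measurable_fun [set: mR R] (fun x : mR R => (x + c)%R : mR R).
  measurability.
move=> mA; apply/esym.
(* The measure structure of a pushforward takes the measurability proof as an
   argument, which unification does not find. *)
apply: (@lebesgue_measure_unique
  _ (measure_function_pushforward__canonical__measure_function_Measure leb mc))
  => // _ [[a b]] _ <-.
rewrite /= /pushforward.
rewrite (_ : _ @^-1` _ = `]a - c, b - c]%classic)%R; last first.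
  by apply/seteqP; split=> x /=; rewrite !in_itv /= ltrBlDr lerBrDr.
rewrite !lebesgue_measure_itv /= !lte_fin ltrD2r -!EFinB.
by rewrite opprB addrA subrK.
Qed.

Lemma ge0_integral_translation (f : mR R -> \bar R) (c : R) :
  measurable_fun setT f -> (forall x, 0 <= f x) ->
  \int[leb]_x f (x + c)%R = \int[leb]_x f x.
Proof.
move=> mf f0.
have mc : measurable_fun [set: mR R] (fun x : mR R => (x + c)%R : mR R)
  by measurability.
transitivity (\int[pushforward leb (fun x : mR R => (x + c)%R : mR R)]_x f x).
  by rewrite ge0_integral_pushforward.
by apply: eq_measure_integral => A mA _; exact: lebesgue_measure_translation.
Qed.

(** The integral of a nonnegative function is the supremum of the integrals of
    the simple functions below it, so nonmeasurable functions are covered.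
    This spares measurability proofs for balls and for the neighborhood of the
    surface. *)
Lemma ge0_le_integral_pointwise d (T : measurableType d)
  (mu : {measure set T -> \bar R}) (f g : T -> \bar R) :
  (forall x, 0 <= f x) -> (forall x, f x <= g x) ->
  \int[mu]_x f x <= \int[mu]_x g x.
Proof.
move=> f0 fg; have g0 x : 0 <= g x by exact: le_trans (fg x).
rewrite !ge0_integralTE//; apply: le_ereal_sup => _ [h hf <-]; exists h => //.
by move=> x; exact: le_trans (hf x) (fg x).
Qed.

End basic.

Section tonelli.
Context {R : realType}.
Local Notation leb := (@lebesgue_measure R).
Local Open Scope ereal_scope.

Lemma ge0_integral_leb3 (f : R3 R -> \bar R) :
  measurable_fun setT f -> (forall x, 0 <= f x) ->
  \int[leb3 R]_x f x = \int[leb]_a \int[leb]_b \int[leb]_c f (a, b, c).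
Proof.
move=> mf f0.
rewrite /leb3 fubini_tonelli1//= /fubini_F /leb2.
rewrite (fubini_tonelli1 (fun y => \int[leb]_c f (y, c)))//.
  exact: (measurable_fun_fubini_tonelli_F (m2 := leb)).
by move=> x; exact: integral_ge0.
Qed.

Lemma ge0_integral_leb3_translation (f : R3 R -> \bar R) (v : R3 R) :
  measurable_fun setT f -> (forall x, 0 <= f x) ->
  \int[leb3 R]_x f (x + v)%R = \int[leb3 R]_x f x.
Proof.
move=> mf f0.
have mv : measurable_fun setT (fun x : R3 R => (x + v)%R : R3 R).
  rewrite (_ : (fun x => _) = fun x : R3 R =>
    (x.1.1 + v.1.1, x.1.2 + v.1.2, x.2 + v.2)%R); last first.
    by apply/funext => -[[]].
  by measurability.
rewrite (ge0_integral_leb3 mf f0).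
rewrite (@ge0_integral_leb3 (fun x => f (x + v)%R)) => [||//]; last first.
  exact: (measurableT_comp mf mv).
have mf3 a b : measurable_fun setT (fun c : mR R => f (a, b, c)).
  by measurability.
have m3 : measurable_fun setT (fun ab : mR R * mR R => \int[leb]_c f (ab, c)).
  exact: (measurable_fun_fubini_tonelli_F (m2 := leb)).
have m2 a : measurable_fun setT (fun b : mR R => \int[leb]_c f (a, b, c)).
  exact: (measurableT_comp m3 (pair1_measurable a)).
transitivity (\int[leb]_a \int[leb]_b \int[leb]_c f (a + v.1.1, b + v.1.2,
  c)%R).
  apply: eq_integral => a _; apply: eq_integral => b _.
  exact: (@ge0_integral_translation _ (fun c => f (a + v.1.1, b + v.1.2, c)%R)).
transitivity (\int[leb]_a \int[leb]_b \int[leb]_c f (a + v.1.1, b, c)%R).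
  apply: eq_integral => a _.
  apply: (@ge0_integral_translation _ (fun b =>
    \int[leb]_c f (a + v.1.1, b, c)%R)) => // b.
  exact: integral_ge0.
apply: (@ge0_integral_translation _ (fun a =>
  \int[leb]_b \int[leb]_c f (a, b, c)%R)) => [|x].
  apply: (measurable_fun_fubini_tonelli_F (m2 := leb) (fun ab =>
    \int[leb]_c f (ab, c))) => // x.
  exact: integral_ge0.
by apply: integral_ge0 => ? _; exact: integral_ge0.
Qed.

End tonelli.

(** * The Laplace weight and its Fourier transform *)

Section halfline.
Context {R : realType}.
Local Notation leb := (@lebesgue_measure R).

(** The derivative is given as a conjunction and not as an instance of
    [is_derive], because type class inference would then be asked for it at
    every application. *)
Lemma ge0_FTC_halfline (f F : R -> R) (l : R) :
  (forall x, 0 <= x -> 0 <= f x) -> continuous f ->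
  (forall x : R, derivable F x 1 /\ 'D_1 F x = f x) -> F x @[x --> +oo] --> l ->
  (\int[leb]_(x in `[0%R, +oo[) (f x)%:E = (l - F 0)%:E)%E.
Proof.
move=> f0 cf dF Fl.
have cF : continuous F.
  by move=> x; apply: differentiable_continuous; apply/derivable1_diffP;
    case: (dF x).
rewrite (ge0_continuous_FTC2y f0 _ Fl) //.
- apply: continuous_subspaceT. exact: cf.
- by move=> x _; case: (dF x).
- apply: cvg_at_right_filter; exact: cF.
- by move=> x _; rewrite derive1E; case: (dF x).
Qed.

Lemma ge0_integral_symm (f : mR R -> \bar R) :
  measurable_fun setT f -> (forall x, (0 <= f x)%E) ->
  (\int[leb]_x f x = \int[leb]_(x in `[0%R, +oo[) f x +
    \int[leb]_(x in `[0%R, +oo[) f (- x)%R)%E.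
Proof.
move=> mf f0.
have mfN : measurable_fun setT (fun x : mR R => f (- x)) by measurability.
rewrite (@ge0_integration_by_substitution0 _ (fun x => f (- x)))//.
have -> : [set: mR R] = `]-oo, 0%R]%classic `|` `]0%R, +oo[%classic.
  by apply/seteqP; split=> x //= _; rewrite !in_itv /= andbT; case: leP;
    [left|right].
rewrite ge0_integral_setU//=.
- rewrite addeC; congr (_ + _)%E.
    rewrite integral_itv_obnd_cbnd//; exact: measurable_funTS.
  by under [RHS]eq_integral do rewrite opprK.
- exact: measurable_funTS.
- apply/disj_setPS => x [] /=; rewrite !in_itv /= andbT => /le_lt_trans h /h.
  by rewrite ltxx.
Qed.

End halfline.

Section laplace_kernel.
Context {R : realType} (l : R) (l0 : 0 < l).
Local Notation leb := (@lebesgue_measure R).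

Definition laplace_weight (t : R) : R := expR (- (l * `|t|)).
(** The Fourier transform of [laplace_weight], by [laplace_line]: the Poisson
    kernel of the line up to normalization. *)
Definition poisson_factor (eta : R) : R := 2 * l / (l ^+ 2 + eta ^+ 2).
Local Notation w := laplace_weight.
Local Notation k := poisson_factor.

Let den eta : l ^+ 2 + eta ^+ 2 != 0.
Proof. by rewrite gt_eqF // ltr_pwDl ?sqr_ge0 // exprn_gt0. Qed.

Lemma poisson_factor_ge0 eta : 0 <= k eta.
Proof. by rewrite divr_ge0 ?addr_ge0 ?sqr_ge0 // mulr_ge0 // ltW. Qed.

Lemma poisson_factor_le eta : k eta <= 2 / l.
Proof.
rewrite /k ler_pdivrMr ?ltr_pwDl ?sqr_ge0 ?exprn_gt0 //.
rewrite mulrAC ler_pdivlMr // -mulrA -expr2 ler_pM2l // lerDl sqr_ge0//.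
Qed.

(** The constant A >= B makes the integrand nonnegative, which brings an
    oscillating integral within reach of the fundamental theorem of calculus
    on a half-line and of Tonelli's theorem. The phase u is there to iterate
    over the coordinates. *)
Lemma laplace_halfline (A B u eta : R) : 0 <= B <= A ->
  (\int[leb]_(t in `[0%R, +oo[)
    (expR (- (l * t)) * (A + B * cos (u + eta * t)))%:E
   = (A / l + B * (l * cos u - eta * sin u) / (l ^+ 2 + eta ^+ 2))%:E)%E.
Proof.
move=> /andP[B0 BA].
(* exp (- l t) G (t) is a primitive. *)
pose G t := - A / l + B * (eta * sin (u + eta * t) - l * cos (u + eta * t)) /
  (l ^+ 2 + eta ^+ 2).
etransitivity; first apply: (@ge0_FTC_halfline _ _ (fun t =>
  expR (- (l * t)) * G t) 0).
- move=> x _; rewrite mulr_ge0 ?expR_ge0//.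
  have : - B <= B * cos (u + eta * x).
    rewrite -[leLHS]mulrN1 ler_wpM2l //; exact: cos_geN1.
  lra.
- by move=> x; apply: differentiable_continuous; apply/derivable1_diffP;
  exact: ex_derive.
- move=> x; suff: is_derive x 1 (fun t => expR (- (l * t)) * G t)
      (expR (- (l * x)) * (A + B * cos (u + eta * x))) by case.
  rewrite /G; apply: is_derive_eq.
  rewrite /GRing.scale /=; field.
  by rewrite den gt_eqF.
- pose C := `|- A / l| + `|B / (l ^+ 2 + eta ^+ 2)| * (`|eta| + `|l|).
  have GC t : `|G t| <= C.
    rewrite /G (le_trans (ler_normD _ _)) // lerD2l mulrAC normrM ler_wpM2l //.
    rewrite (le_trans (ler_normB _ _)) // lerD // normrM ler_piMr //.
      by rewrite ler_norml sin_geN1 sin_le1.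
    by rewrite ler_norml cos_geN1 cos_le1.
  have e0 : C * expR (- (l * t)) @[t --> +oo] --> (0 : R).
    rewrite -(mulr0 C); apply: cvgMr.
    apply: (cvg_comp (fun t => l * t) (fun t => expR (- t)));
      last exact: cvgr_expR.
    exact: gt0_cvgMry.
  apply: (@squeeze_cvgr _ _ _ _ (fun t => - (C * expR (- (l * t)))) (fun t =>
    C * expR (- (l * t)))) => //.
    apply: nearW => t.
    have := GC t; rewrite ler_norml => /andP[h1 h2].
    rewrite -mulNr mulrC ler_wpM2l ?expR_ge0 //= mulrC ler_wpM2r ?expR_ge0 //.
  rewrite -oppr0; exact: cvgN.
- rewrite /G !mulr0 !addr0 oppr0 expR0; congr EFin; field.
  by rewrite den gt_eqF.
Qed.

End laplace_kernel.

Section laplace_line.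
Context {R : realType} (l : R) (l0 : 0 < l).
Local Notation leb := (@lebesgue_measure R).
Local Notation w := (laplace_weight l).
Local Notation k := (poisson_factor l).

Lemma measurable_laplace_weight : measurable_fun [set: mR R] w.
Proof. by rewrite /laplace_weight; measurability. Qed.

Lemma laplace_weight_ge0 t : 0 <= w t. Proof. exact: expR_ge0. Qed.

Lemma measurable_poisson_factor : measurable_fun [set: R] k.
Proof.
have c : continuous (fun eta : R => (l ^+ 2 + eta ^+ 2)^-1).
  move=> x; apply: cvgV;
    first by rewrite gt_eqF // ltr_pwDl ?sqr_ge0 // exprn_gt0.
  apply: cvgD; first exact: cvg_cst.
  exact: exprn_continuous.
rewrite /poisson_factor; measurability. exact: continuous_measurable_fun.
Qed.

Lemma poisson_factorN x : k (- x) = k x.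
Proof. by rewrite /poisson_factor sqrrN. Qed.

(** The sine terms of the two half-lines cancel. What is left has again the
    shape A + B cos, now as a function of the phase. *)
Lemma laplace_line (A B u eta : R) : 0 <= B <= A ->
  (\int[leb]_t (w t * (A + B * cos (u + eta * t)))%:E
   = (2 * A / l + B * k eta * cos u)%:E)%E.
Proof.
move=> BA.
rewrite ge0_integral_symm; last 2 first.
- rewrite /laplace_weight; measurability.
- move=> t; rewrite lee_fin mulr_ge0 ?expR_ge0//.
  have : - B <= B * cos (u + eta * t).
    rewrite -[leLHS]mulrN1 ler_wpM2l //; first by case/andP: BA.
    exact: cos_geN1.
  case/andP: BA; lra.
have E v et : (\int[leb]_(t in `[0%R, +oo[)
  (w t * (A + B * cos (v + et * t)))%:E =
    (A / l + B * (l * cos v - et * sin v) / (l ^+ 2 + et ^+ 2))%:E)%E.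
  rewrite -(laplace_halfline l0 v et BA); apply: eq_integral => t.
  rewrite inE /= in_itv /= andbT => t0.
  by rewrite /laplace_weight ger0_norm.
rewrite E.
have -> : (\int[leb]_(t in `[0%R, +oo[)
  (w (- t) * (A + B * cos (u + eta * - t)))%:E =
    \int[leb]_(t in `[0%R, +oo[) (w t * (A + B * cos (u + (- eta) * t)))%:E)%E.
  apply: eq_integral => t _; rewrite /laplace_weight normrN.
  by rewrite mulNr mulrN.
rewrite E -EFinD sqrrN /poisson_factor; congr EFin; field.
by rewrite !gt_eqF // ltr_pwDl ?sqr_ge0 // exprn_gt0.
Qed.

(** The function atan (2 pi y / l) / pi is a primitive, so the mass does not
    depend on l. *)
Lemma integral_poisson_factor :
  (\int[leb]_y (k (2 * pi * y))%:E = 1)%E.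
Proof.
have mk : measurable_fun [set: mR R] (fun y => (k (2 * pi * y))%:E).
  apply: measurable_EFin_comp;
    apply: (measurableT_comp measurable_poisson_factor).
  by measurability.
rewrite ge0_integral_symm//; last by move=> y;
  rewrite lee_fin poisson_factor_ge0.
have cy : (fun y => pi^-1 * atan (2 * pi / l * y)) y @[y --> +oo] -->
  (2^-1 : R).
  rewrite (_ : 2^-1 = pi^-1 * (pi / 2)); last first.
    by rewrite mulrA mulVf ?mul1r // gt_eqF // pi_gt0.
  apply: cvgMr.
  apply: (cvg_comp (fun y => 2 * pi / l * y) (@atan R)); last exact: cvgy_atan.
  by apply: gt0_cvgMry => //; rewrite divr_gt0 // mulr_gt0 // pi_gt0.
have D x : l ^+ 2 + (2 * pi * x) ^+ 2 != 0.
  by rewrite gt_eqF // ltr_pwDl ?sqr_ge0 // exprn_gt0.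
have E : (\int[leb]_(y in `[0%R, +oo[) (k (2 * pi * y))%:E = (2^-1)%:E)%E.
  etransitivity; first apply: (@ge0_FTC_halfline _ _ (fun y =>
    pi^-1 * atan (2 * pi / l * y)) 2^-1).
  - by move=> y _; exact: poisson_factor_ge0.
  - move=> x; apply: differentiable_continuous; apply/derivable1_diffP.
    rewrite /poisson_factor; apply: derivableM; first exact: derivable_cst.
    by apply: derivableV.
  - move=> x; suff: is_derive x 1 (fun y => pi^-1 * atan (2 * pi / l * y))
    (k (2 * pi * x)) by case.
    apply: is_derive_eq.
    rewrite /GRing.scale /= /poisson_factor.
    (* The field tactic would unfold pi. *)
    move: (D x) (pi_gt0 R); move: (@pi R) => p Dp p0; field.
    by apply/and3P; split; rewrite gt_eqF // ltr_pwDl ?sqr_ge0 // exprn_gt0.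
  - exact: cy.
  - by rewrite /= mulr0 atan0 mulr0 subr0.
rewrite E (_ : (\int[leb]_(x in _) _ = (2^-1)%:E)%E).
  by rewrite -EFinD; congr EFin; lra.
by rewrite -E; apply: eq_integral => y _; rewrite mulrN poisson_factorN.
Qed.

End laplace_line.

Section laplace3.
Context {R : realType} (l : R) (l0 : 0 < l).
Local Notation leb := (@lebesgue_measure R).
Local Notation w := (laplace_weight l).
Local Notation k := (poisson_factor l).

Definition weight3 (x : R3 R) : R := w x.1.1 * w x.1.2 * w x.2.
Definition kernel3 (y : R3 R) : R := k (2 * pi * y.1.1) * k (2 * pi * y.1.2)
  * k (2 * pi * y.2).

Lemma measurable_weight3 : measurable_fun setT weight3.
Proof. by rewrite /weight3; have := measurable_laplace_weight l => h;
  measurability. Qed.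

Lemma measurable_kernel3 : measurable_fun setT kernel3.
Proof. by rewrite /kernel3; have := measurable_poisson_factor l0 => h;
  measurability. Qed.

Lemma weight3_ge0 x : 0 <= weight3 x.
Proof. by rewrite !mulr_ge0 // laplace_weight_ge0. Qed.

Lemma kernel3_ge0 x : 0 <= kernel3 x.
Proof. by apply: mulr_ge0; [apply: mulr_ge0|]; exact: poisson_factor_ge0. Qed.

Lemma kernel3N y : kernel3 (- y) = kernel3 y.
Proof. by rewrite /kernel3 /= !mulrN !poisson_factorN. Qed.

Lemma integral_kernel3 : (\int[leb3 R]_y (kernel3 y)%:E = 1)%E.
Proof.
have mk := measurable_poisson_factor l0.
rewrite ge0_integral_leb3; last 2 first.
- by apply: measurable_EFin_comp; exact: measurable_kernel3.
- by move=> x; rewrite lee_fin kernel3_ge0.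
have m1 : measurable_fun [set: mR R] (fun y => (k (2 * pi * y))%:E)
  by measurability.
have k0 y : (0 <= (k (2 * pi * y))%:E)%E by rewrite lee_fin poisson_factor_ge0.
have E a : 0 <= a -> (\int[leb]_y (a * k (2 * pi * y))%:E = a%:E)%E.
  move=> a0; under eq_integral => c _ do rewrite EFinM.
  by rewrite ge0_integralZl// (integral_poisson_factor l0) mule1.
under eq_integral => a _.
  under eq_integral => b _.
    rewrite /kernel3 /= E; last by apply: mulr_ge0; exact: poisson_factor_ge0.
    over.
  rewrite E; last exact: poisson_factor_ge0.
  over.
exact: integral_poisson_factor.
Qed.

(** Each coordinate in turn is integrated by [laplace_line], whose result has
    the shape of its integrand; [poisson_factor_le] preserves the condition B
    <= A. *)
Lemma integral_weight3_cos (A B u : R) (y : R3 R) : 0 <= B <= A ->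
  (\int[leb3 R]_x (weight3 x * (A + B * cos (u + 2 * pi * dot3 y x)))%:E =
    (8 * A / l ^+ 3 + B * kernel3 y * cos u)%:E)%E.
Proof.
have mw := measurable_laplace_weight l.
move=> BA; have /andP[B0 BA'] := BA.
have pos C D v : 0 <= D <= C -> 0 <= C + D * cos v.
  move=> /andP[D0 DC].
  have : - D <= D * cos v by rewrite -[leLHS]mulrN1 ler_wpM2l //;
    exact: cos_geN1.
  lra.
have step C D eta : 0 <= D <= C -> 0 <= D * k eta <= 2 * C / l.
  move=> /andP[D0 DC]; rewrite mulr_ge0 ?poisson_factor_ge0 //=.
  rewrite [2 * C]mulrC -mulrA ler_pM ?poisson_factor_ge0 //.
  exact: poisson_factor_le.
rewrite ge0_integral_leb3; last 2 first.
- by rewrite /weight3 /dot3 /dot2; measurability.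
- by move=> x; rewrite lee_fin mulr_ge0 ?weight3_ge0 // pos.
pose e1 := 2 * pi * y.1.1; pose e2 := 2 * pi * y.1.2; pose e3 := 2 * pi * y.2.
have E3 a b : (\int[leb]_c
  (weight3 (a, b, c) * (A + B * cos (u + 2 * pi * dot3 y (a, b, c))))%:E =
   (w a * w b * (2 * A / l + B * k e3 * cos (u + e1 * a + e2 * b)))%:E)%E.
  rewrite [RHS]EFinM -(laplace_line l0 (u + e1 * a + e2 * b) e3 BA)
    -ge0_integralZl//.
  - apply: eq_integral => c _; rewrite -EFinM; congr EFin.
    rewrite /weight3 /dot3 /dot2 /e1 /e2 /e3 /= -!mulrA;
      congr (_ * (_ * (_ * (_ + _ * cos _)))).
    ring.
  - measurability.
  - by move=> x _; rewrite lee_fin mulr_ge0 ?laplace_weight_ge0 // pos.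
  - by rewrite lee_fin mulr_ge0 ?laplace_weight_ge0.
have BA3 := step A B e3 BA.
have E2 a : (\int[leb]_b
  (w a * w b * (2 * A / l + B * k e3 * cos (u + e1 * a + e2 * b)))%:E
   = (w a * (2 * (2 * A / l) / l + B * k e3 * k e2 * cos (u + e1 * a)))%:E)%E.
  rewrite [RHS]EFinM -(laplace_line l0 (u + e1 * a) e2 BA3) -ge0_integralZl//.
  - by apply: eq_integral => b _; rewrite -EFinM -mulrA.
  - measurability.
  - by move=> x _; rewrite lee_fin mulr_ge0 ?laplace_weight_ge0 // pos.
  - by rewrite lee_fin laplace_weight_ge0.
have BA2 := step _ _ e2 BA3.
under eq_integral => a _.
  under eq_integral => b _ do rewrite E3.
  rewrite E2; over.
rewrite (laplace_line l0 u e1 BA2); congr EFin.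
rewrite /kernel3 -/e1 -/e2 -/e3; field.
by rewrite gt_eqF.
Qed.

Lemma integral_weight3 : (\int[leb3 R]_x (weight3 x)%:E = (8 / l ^+ 3)%:E)%E.
Proof.
have h : (0 <= 0 :> R) && (0 <= 1 :> R) by rewrite lexx ler01.
rewrite -[RHS](_ : (8 * 1 / l ^+ 3 + 0 * kernel3 0 * cos 0)%:E = _); last first.
  by rewrite !mul0r addr0 mulr1.
rewrite -(integral_weight3_cos _ _ h); apply: eq_integral => x _.
by rewrite mul0r addr0 mulr1.
Qed.

Lemma integrable_weight3 : (leb3 R).-integrable setT (EFin \o weight3).
Proof.
apply/integrableP; split; first by apply: measurable_EFin_comp;
  exact: measurable_weight3.
under eq_integral => x _ do rewrite /= (ger0_norm (weight3_ge0 x)).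
by rewrite integral_weight3 ltry.
Qed.

Lemma Rintegral_weight3_cos (y : R3 R) :
  \int[leb3 R]_x (weight3 x * cos (2 * pi * dot3 y x)) = kernel3 y.
Proof.
have h : (0 <= 1 :> R) && (1 <= 1 :> R) by rewrite lexx ler01.
have mw := measurable_weight3.
have I1 := integrable_weight3.
have I2 : (leb3 R).-integrable setT
  (EFin \o (fun x => weight3 x * cos (2 * pi * dot3 y x))).
  apply: (le_integrable measurableT _ _ I1).
    by apply: measurable_EFin_comp; rewrite /dot3 /dot2 /=; measurability.
  move=> x _ /=; rewrite lee_fin normrM ler_piMr //.
  by rewrite ler_norml cos_geN1 cos_le1.
have : \int[leb3 R]_x (weight3 x + weight3 x * cos (2 * pi * dot3 y x)) =
  8 / l ^+ 3 + kernel3 y.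
  have := integral_weight3_cos 0 y h; rewrite cos0 !(mulr1, mul1r) => E.
  rewrite /Rintegral -[RHS]/(fine (8 / l ^+ 3 + kernel3 y)%:E) -E; congr fine.
  by apply: eq_integral => x _;
    rewrite add0r ?mul1r [in RHS](mulrDr (weight3 x)) mulr1 ?mul1r.
rewrite RintegralD// [X in X + _]/Rintegral integral_weight3 /= => /addrI.
by [].
Qed.

End laplace3.

(** * Integrals depending on a parameter *)

Section parameter_integrals.
Context d1 d2 (T : measurableType d1) (X : measurableType d2) {R : realType}.
Variables (mu : {sigma_finite_measure set T -> \bar R})
  (nu : {sigma_finite_measure set X -> \bar R}).

Lemma measurable_parameter_integral (f : T * X -> \bar R) :
  measurable_fun setT f -> measurable_fun setT (fun x => \int[mu]_t f (t, x))%E.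
Proof.
move=> mf; rewrite (_ : (fun _ => _) =
    (fun x => \int[mu]_t (f^\+ (t, x)) - \int[mu]_t (f^\- (t, x)))%E);
      last first.
  apply/funext => x; rewrite [LHS]integralE.
  under eq_integral do rewrite (funepos_comp f (fun t => (t, x))) /=.
  by under [X in (_ - X)%E = _]eq_integral do rewrite (funeneg_comp f (fun t =>
    (t, x))) /=.
apply: emeasurable_funB.
- apply: (measurable_fun_fubini_tonelli_G (m1 := mu) (f^\+)%E) => //.
  exact: measurable_funepos.
- apply: (measurable_fun_fubini_tonelli_G (m1 := mu) (f^\-)%E) => //.
  exact: measurable_funeneg.
Qed.

Lemma measurable_parameter_Rintegral (f : T * X -> R) :
  measurable_fun setT f -> measurable_fun setT (fun x => \int[mu]_t f (t, x)).
Proof.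
move=> mf; apply: (measurableT_comp (f := fine)) => //.
apply: (measurable_parameter_integral (f := fun z => (f z)%:E));
  exact: measurable_EFin_comp.
Qed.

(** An infinite integral has the real value 0, so f can be any measurable
    function. *)
Lemma le_abs_Rintegral (f : T -> R) : measurable_fun setT f ->
  ((`|\int[mu]_t f t|)%:E <= \int[mu]_t (`|f t|)%:E)%E.
Proof.
move=> mf; rewrite /Rintegral.
apply: le_trans (le_abse_integral mu measurableT (measurable_EFin_comp mf)).
by case: (\int[mu]_t (f t)%:E)%E => //= *; rewrite normr0 leey.
Qed.

Variables (g : T -> R) (W : X -> R) (c : T * X -> R) (M : R).
Hypotheses (ig : mu.-integrable setT (EFin \o g))
  (iW : nu.-integrable setT (EFin \o W)).
Hypotheses (mc : measurable_fun setT c) (cM : forall z, `|c z| <= M).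

Let mg : measurable_fun setT g.
Proof. exact/measurable_EFinP/(measurable_int mu ig). Qed.

Let mW : measurable_fun setT W.
Proof. exact/measurable_EFinP/(measurable_int nu iW). Qed.

Lemma integrable_tensor :
  (mu \x nu)%E.-integrable setT (EFin \o (fun z => g z.1 * W z.2)).
Proof.
apply/integrable12ltyP; first by apply: measurable_EFin_comp; measurability.
have Wfin : (\int[nu]_x `|(W x)%:E| < +oo)%E by case/integrableP: iW.
have gfin : (\int[mu]_t `|(g t)%:E| < +oo)%E by case/integrableP: ig.
rewrite (_ : (\int[mu]_x _)%E = (\int[mu]_t `|(g t)%:E|) *
  (\int[nu]_x `|(W x)%:E|))%E.
  apply: lte_mul_pinfty => //; first exact: integral_ge0.
  by rewrite ge0_fin_numE // integral_ge0.
rewrite -ge0_integralZr//; last 2 first.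
- by apply: measurable_EFin_comp; measurability.
- exact: integral_ge0.
apply: eq_integral => t _; rewrite -ge0_integralZl//;
  last by apply: measurable_EFin_comp; measurability.
by apply: eq_integral => x _; rewrite /= normrM EFinM.
Qed.

Lemma integrable_tensor_bounded :
  (mu \x nu)%E.-integrable setT (EFin \o (fun z => g z.1 * W z.2 * c z)).
Proof.
have i1 := integrableZl measurableT M integrable_tensor.
apply: (le_integrable measurableT _ _ i1);
  first by apply: measurable_EFin_comp; measurability.
move=> z _ /=; rewrite lee_fin mulrC !normrM ler_wpM2r //.
by rewrite (le_trans (cM z)) // ler_norm.
Qed.

Lemma integrable_bounded (d : measure_display) (Y : measurableType d)
    (m : {measure set Y -> \bar R}) (f b : Y -> R) (N : R) :
  m.-integrable setT (EFin \o f) -> measurable_fun setT b ->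
  (forall y, `|b y| <= N) -> m.-integrable setT (EFin \o (fun y => f y * b y)).
Proof.
move=> i mb bN.
have mf : measurable_fun setT f by exact/measurable_EFinP/(measurable_int m i).
have i1 := integrableZl measurableT N i.
apply: (le_integrable measurableT _ _ i1);
  first by apply: measurable_EFin_comp; measurability.
move=> z _ /=; rewrite lee_fin mulrC !normrM ler_wpM2r //.
by rewrite (le_trans (bN z)) // ler_norm.
Qed.

(** Fubini's theorem for g (t) W (x) c (t, x), which is integrable because c
    is bounded and g (t) W (x) is a tensor product. *)
Lemma Rintegral_swap :
  \int[nu]_x (W x * \int[mu]_t (g t * c (t, x))) =
  \int[mu]_t (g t * \int[nu]_x (W x * c (t, x))).
Proof.
have m1 x : measurable_fun setT (fun t => c (t, x)) by measurability.
have m2 t : measurable_fun setT (fun x => c (t, x)) by measurability.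
have E := Fubini integrable_tensor_bounded.
rewrite /Rintegral; congr fine;
  transitivity (\int[nu]_x \int[mu]_t (g t * W x * c (t, x))%:E)%E.
  apply: eq_integral => x _.
  have ix : mu.-integrable setT (EFin \o (fun t => g t * c (t, x))).
    exact: (integrable_bounded ig).
  rewrite EFinM fineK; last exact: integrable_fin_num.
  rewrite -integralZl //; apply: eq_integral => t _ /=.
  by rewrite -EFinM mulrCA mulrA.
rewrite -E; apply: eq_integral => t _.
have it : nu.-integrable setT (EFin \o (fun x => W x * c (t, x))).
  exact: (integrable_bounded iW).
rewrite EFinM fineK; last exact: integrable_fin_num.
rewrite -integralZl //; apply: eq_integral => x _ /=.
by rewrite -EFinM mulrA.
Qed.

Lemma integrable_swap :
  mu.-integrable setT (EFin \o (fun t => g t * \int[nu]_x (W x * c (t, x)))).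
Proof.
apply: eq_integrable (integrable_fubini_F integrable_tensor_bounded) => // t _.
have it : nu.-integrable setT (EFin \o (fun x => W x * c (t, x))).
  by apply: (integrable_bounded iW) => //; measurability.
rewrite /= EFinM fineK; last exact: integrable_fin_num.
rewrite -integralZl //; apply: eq_integral => x _ /=.
by rewrite -EFinM mulrA.
Qed.

End parameter_integrals.

(** * A weighted Bessel inequality *)

Section bessel.
Context d (T : measurableType d) {R : realType}.
Variables (mu : {sigma_finite_measure set T -> \bar R}) (l : R) (l0 : 0 < l).
Variables (g : T -> R) (th : T -> R3 R).
Hypotheses (ig : mu.-integrable setT (EFin \o g))
  (mth : measurable_fun setT th).
Local Notation W := (weight3 l).
Local Notation K := (kernel3 l).
Let phase (t : T) (x : R3 R) := 2 * pi * dot3 (th t) x.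
Let A (x : R3 R) := \int[mu]_t (g t * cos (phase t x)).
Let B (x : R3 R) := \int[mu]_t (g t * sin (phase t x)).
Let G := \int[mu]_t `|g t|.

Let mg : measurable_fun setT g.
Proof. exact/measurable_EFinP/(measurable_int mu ig). Qed.

Let mphase : measurable_fun setT (fun z : T * R3 R => phase z.1 z.2).
Proof. by rewrite /phase /dot3 /dot2; measurability. Qed.

Let mW := measurable_weight3 l.
Let mK := measurable_kernel3 l0.
Let iW := integrable_weight3 l0.

Let cos1 (u : R) : `|cos u| <= 1.
Proof. by rewrite ler_norml cos_geN1 cos_le1. Qed.

Let sin1 (u : R) : `|sin u| <= 1.
Proof. by rewrite ler_norml sin_geN1 sin_le1. Qed.

Let mA : measurable_fun setT A.
Proof.
apply: (measurable_parameter_Rintegral mu (f := fun z =>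
  g z.1 * cos (phase z.1 z.2))).
by measurability.
Qed.

Let mB : measurable_fun setT B.
Proof.
apply: (measurable_parameter_Rintegral mu (f := fun z =>
  g z.1 * sin (phase z.1 z.2))).
by measurability.
Qed.

Let bound (b : T -> R) : measurable_fun setT b -> (forall t, `|b t| <= 1) ->
  `|\int[mu]_t (g t * b t)| <= G.
Proof.
move=> mb b1; have i := integrable_bounded ig mb b1.
apply: le_trans (le_normr_Rintegral measurableT i) _.
apply: le_Rintegral => //.
- exact: (integrable_norm i).
- exact: (integrable_norm ig).
- by move=> t _; rewrite normrM ler_piMr.
Qed.

Let mph x : measurable_fun setT (fun t => phase t x).
Proof. by rewrite /phase /dot3 /dot2; measurability. Qed.

Let mph2 t : measurable_fun setT (fun x => phase t x).
Proof. by rewrite /phase /dot3 /dot2; measurability. Qed.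

Let AG x : `|A x| <= G.
Proof. by have m := mph x; apply: bound => //; measurability. Qed.

Let BG x : `|B x| <= G.
Proof. by have m := mph x; apply: bound => //; measurability. Qed.

Let iWA : (leb3 R).-integrable setT (EFin \o (fun x => W x * A x)).
Proof. exact: (integrable_bounded iW mA AG). Qed.

Let iWB : (leb3 R).-integrable setT (EFin \o (fun x => W x * B x)).
Proof. exact: (integrable_bounded iW mB BG). Qed.

Lemma integrable_bessel :
  (leb3 R).-integrable setT (EFin \o (fun x => W x * (A x ^+ 2 + B x ^+ 2))).
Proof.
apply: (integrable_bounded (N := G * G + G * G) iW); first by measurability.
move=> x; rewrite (le_trans (ler_normD _ _)) // !expr2 !normrM lerD //
  ler_pM //.
Qed.

(** A^2 + B^2 is the squared modulus of the integral of g (t) exp (i phase),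
    so its expansion carries cos (phase t - phase s), whose weighted integral
    in x is the kernel. The two factors of the square are expanded one after
    the other, so that Fubini's theorem is used on T * R^3 only. *)
Lemma bessel_identity :
  \int[leb3 R]_x (W x * (A x ^+ 2 + B x ^+ 2)) =
  \int[mu]_t (g t * \int[mu]_s (g s * K (th t - th s))).
Proof.
have mc : measurable_fun setT (fun z : T * R3 R => cos (phase z.1 z.2))
  by measurability.
have ms : measurable_fun setT (fun z : T * R3 R => sin (phase z.1 z.2))
  by measurability.
have mct t : measurable_fun setT (fun x : R3 R => cos (phase t x)).
  by have := mph2 t => h; measurability.
have mst t : measurable_fun setT (fun x : R3 R => sin (phase t x)).
  by have := mph2 t => h; measurability.
have mcx x : measurable_fun setT (fun t => cos (phase t x)).
  by have := mph x => h; measurability.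
have msx x : measurable_fun setT (fun t => sin (phase t x)).
  by have := mph x => h; measurability.
transitivity (\int[leb3 R]_x (W x * A x * A x) + \int[leb3 R]_x
  (W x * B x * B x)).
  rewrite -RintegralD//.
  - by apply: eq_Rintegral => x _; ring.
  - exact: (integrable_bounded iWA mA AG).
  - exact: (integrable_bounded iWB mB BG).
rewrite (Rintegral_swap ig iWA mc (M := 1))//
  (Rintegral_swap ig iWB ms (M := 1))//.
rewrite -RintegralD//; last 2 first.
- exact: (integrable_swap ig iWA mc (M := 1)).
- exact: (integrable_swap ig iWB ms (M := 1)).
apply: eq_Rintegral => t _; rewrite -mulrDr; congr (_ * _).
rewrite -RintegralD//; last 2 first.
- exact: (integrable_bounded iWA (mct t) (N := 1)).
- exact: (integrable_bounded iWB (mst t) (N := 1)).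
transitivity (\int[leb3 R]_x
  (W x * \int[mu]_s (g s * cos (phase t x - phase s x)))).
  apply: eq_Rintegral => x _; rewrite -!(mulrA (W x)) -(mulrDr (W x));
    congr (_ * _).
  have igc := integrable_bounded ig (mcx x) (fun s => cos1 (phase s x)).
  have igs := integrable_bounded ig (msx x) (fun s => sin1 (phase s x)).
  rewrite /A /B -(RintegralZr _ measurableT igc)
    -(RintegralZr _ measurableT igs).
  rewrite -RintegralD//; last 2 first.
  - exact: (integrable_bounded (N := 1) igc).
  - exact: (integrable_bounded (N := 1) igs).
  by apply: eq_Rintegral => s _; rewrite cosB; ring.
have mc' : measurable_fun setT (fun z : T * R3 R =>
  cos (phase t z.2 - phase z.1 z.2)).
  by have := mph2 t => h; measurability.
rewrite (Rintegral_swap ig iW mc' (M := 1))//.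
apply: eq_Rintegral => s _; congr (_ * _).
rewrite -Rintegral_weight3_cos//; apply: eq_Rintegral => x _.
by rewrite /phase /dot3 /dot2 /=; congr (_ * cos _); ring.
Qed.

Variables (E : set T) (V : R).
Hypotheses (mE : measurable E) (gE : forall t, g t = g t * \1_E t).
Hypothesis KV : forall y, (\int[mu]_s (\1_E s * K (y - th s))%:E <= V%:E)%E.

(** Schur's test: |g (t) g (s)| <= (g (t)^2 + g (s)^2) / 2, and in each of the
    two halves the integral in the variable that does not appear in g is at
    most V. *)
Lemma bessel_inequality :
  (\int[leb3 R]_x (W x * (A x ^+ 2 + B x ^+ 2))%:E <=
   V%:E * \int[mu]_t (g t ^+ 2)%:E)%E.
Proof.
have V0 : (0 <= V%:E)%E.
  apply: le_trans (KV 0); apply: integral_ge0 => s _.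
  by rewrite lee_fin mulr_ge0 // kernel3_ge0.
have m1 : measurable_fun setT (fun t => \1_E t : R) by exact: measurable_indic.
have mKd : measurable_fun setT (fun z : T * T => K (th z.1 - th z.2)).
  apply: (measurableT_comp mK).
  by measurability.
have mKt t : measurable_fun setT (fun s => K (th t - th s)) by measurability.
have K0 t s : 0 <= K (th t - th s) by exact: kernel3_ge0.
(* The two halves in Schur's test, exchanged by (t, s) |-> (s, t). *)
pose a (z : T * T) := 2^-1 * (g z.1 ^+ 2 * (\1_E z.2 * K (th z.1 - th z.2))).
pose b (z : T * T) := 2^-1 * (g z.2 ^+ 2 * (\1_E z.1 * K (th z.2 - th z.1))).
have ma : measurable_fun setT a by rewrite /a; measurability.
have mb : measurable_fun setT b.
  by rewrite /b; measurability.
have a0 z : (0 <= (a z)%:E)%E.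
  rewrite lee_fin; apply: mulr_ge0; first by rewrite invr_ge0.
  by apply: mulr_ge0; [exact: sqr_ge0|exact: mulr_ge0].
have b0 z : (0 <= (b z)%:E)%E.
  rewrite lee_fin; apply: mulr_ge0; first by rewrite invr_ge0.
  by apply: mulr_ge0; [exact: sqr_ge0|exact: mulr_ge0].
have mg2 : measurable_fun setT (fun t => (2^-1 * g t ^+ 2)%:E) by measurability.
have half : (\int[mu]_t (2^-1 * g t ^+ 2)%:E * V%:E =
    (2^-1)%:E * (V%:E * \int[mu]_t (g t ^+ 2)%:E))%E.
  under eq_integral do rewrite EFinM.
  rewrite ge0_integralZl//.
  - by rewrite -muleA; congr (_ * _)%E; rewrite muleC.
  - by measurability.
  - by move=> t _; rewrite lee_fin sqr_ge0.
have ha : (\int[mu]_t \int[mu]_s (a (t, s))%:E <=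
    (2^-1)%:E * (V%:E * \int[mu]_t (g t ^+ 2)%:E))%E.
  rewrite -half -ge0_integralZr//; last first.
    by move=> t _; rewrite lee_fin mulr_ge0 ?sqr_ge0.
  apply: ge0_le_integral_pointwise => t; first exact: integral_ge0.
  rewrite /a /=; under eq_integral => s _ do rewrite mulrA EFinM.
  rewrite ge0_integralZl//.
  - by apply: lee_wpmul2l => //; rewrite lee_fin mulr_ge0 ?sqr_ge0.
  - by measurability.
  - by move=> s _; rewrite lee_fin mulr_ge0.
  - by rewrite lee_fin mulr_ge0 ?sqr_ge0.
have hb : (\int[mu]_t \int[mu]_s (b (t, s))%:E <=
    (2^-1)%:E * (V%:E * \int[mu]_t (g t ^+ 2)%:E))%E.
  rewrite (fubini_tonelli (fun z => (b z)%:E))//; measurability.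
apply: (@le_trans _ _ (\int[mu]_t \int[mu]_s (a (t, s) + b (t, s))%:E)%E).
  rewrite -(fineK (integrable_fin_num measurableT integrable_bessel)).
  rewrite -/(Rintegral _ _ _) bessel_identity.
  apply: le_trans (_ : (`|\int[mu]_t
    (g t * \int[mu]_s (g s * K (th t - th s)))|%:E <= _)%E).
    by rewrite lee_fin ler_norm.
  apply: le_trans (le_abs_Rintegral _ _) _.
    have := measurable_parameter_Rintegral mu (f := fun z =>
      g z.1 * K (th z.2 - th z.1)) => h.
    by apply: measurable_mulr => //; apply: h; measurability.
  apply: ge0_le_integral_pointwise => t //.
  rewrite normrM EFinM;
    apply: le_trans (lee_wpmul2l _ (le_abs_Rintegral _ _)) _ => //.
    by measurability.
  rewrite -ge0_integralZl//; last by measurability.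
  apply: ge0_le_integral_pointwise => s; first by rewrite mule_ge0.
  rewrite -EFinM lee_fin /a /b /= normrM (ger0_norm (K0 _ _)).
  rewrite (gE t) (gE s) !normrM.
  have e0 u : 0 <= \1_E u :> R by [].
  have e2 u : (\1_E u : R) ^+ 2 = \1_E u.
    by rewrite indicE; case: (_ \in _); rewrite ?expr1n ?expr0n.
  rewrite !exprMn !e2 -[th s - th t]opprB kernel3N !(ger0_norm (e0 _)).
  rewrite -[g t ^+ 2]real_normK ?num_real // -[g s ^+ 2]real_normK ?num_real //.
  set p := `|g t|; set q := `|g s|; set k := K _.
  have : 0 <= \1_E t * \1_E s * k * (p - q) ^+ 2.
    apply: mulr_ge0; last exact: sqr_ge0.
    by apply: mulr_ge0; [exact: mulr_ge0|exact: K0].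
  move: (\1_E t) (\1_E s) => x1 x2; lra.
under eq_integral => t _.
  under eq_integral => s _ do rewrite EFinD.
  rewrite ge0_integralD//; [over|measurability|measurability].
rewrite ge0_integralD//; last 4 first.
- by move=> t _; exact: integral_ge0.
- apply: (measurable_fun_fubini_tonelli_F (m2 := mu) (fun z =>
  (a z)%:E)) => //; measurability.
- by move=> t _; exact: integral_ge0.
- apply: (measurable_fun_fubini_tonelli_F (m2 := mu) (fun z =>
  (b z)%:E)) => //; measurability.
apply: le_trans (leeD ha hb) _.
rewrite -ge0_muleDl ?lee_fin//.
rewrite -EFinD (_ : 2^-1 + 2^-1 = 1 :> R) ?mul1e//; lra.
Qed.

End bessel.

(** * The fourth power of a Fourier transform *)

Section leb6.
Variable R : realType.
(** The product measure has a name so that its sigma-finiteness can be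
    inferred. *)
Definition leb6 : set (R3 R * R3 R) -> \bar R := (leb3 R \x leb3 R)%E.
HB.instance Definition _ := Measure.on leb6.
HB.instance Definition _ := Measure_isSigmaFinite.Build _ _ _ leb6
  (product_sigma_finite (leb3 R) (leb3 R)).
End leb6.
Arguments leb6 : clear implicits.

Section tensor.
Context d1 d2 (T : measurableType d1) (X : measurableType d2) {R : realType}.
Variables (mu : {sigma_finite_measure set T -> \bar R})
  (nu : {sigma_finite_measure set X -> \bar R}).
Variables (g : T -> R) (W : X -> R).
Hypotheses (ig : mu.-integrable setT (EFin \o g))
  (iW : nu.-integrable setT (EFin \o W)).

Lemma Rintegral_tensor :
  \int[(mu \x nu)%E]_z (g z.1 * W z.2) = \int[mu]_t g t * \int[nu]_x W x.
Proof.
rewrite {1}/Rintegral -(integral12_prod_meas1 (integrable_tensor ig iW))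
  /fubini_F.
rewrite -RintegralZr//; congr fine; apply: eq_integral => t _ /=.
rewrite EFinM fineK; last exact: integrable_fin_num.
by rewrite -integralZl.
Qed.

End tensor.

Section bilinear.
Context {R : realType} (l : R) (l0 : 0 < l).
Local Notation W := (weight3 l).
Local Notation K := (kernel3 l).
Variables (h : R3 R -> R) (D : set (R3 R)) (M : R).
Hypotheses (ih : (leb3 R).-integrable setT (EFin \o h)) (mD : measurable D).
Hypothesis (hD : forall x, h x = h x * \1_D x).
Hypothesis (DM : forall s : R3 R,
  (\int[leb3 R]_c (\1_D c * \1_D (s - c))%:E <= M%:E)%E).

Let C (x : R3 R) := \int[leb3 R]_y (h y * cos (2 * pi * dot3 y x)).
Let S (x : R3 R) := \int[leb3 R]_y (h y * sin (2 * pi * dot3 y x)).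
Let mh : measurable_fun setT h.
Proof. by have := measurable_int (leb3 R) ih => /measurable_EFinP. Qed.

Let mD1 : measurable_fun setT (\1_D : R3 R -> R).
Proof. exact: measurable_indic. Qed.

Let mcos x : measurable_fun setT (fun y : R3 R => cos (2 * pi * dot3 y x)).
Proof. by rewrite /dot3 /dot2; measurability. Qed.

Let msin x : measurable_fun setT (fun y : R3 R => sin (2 * pi * dot3 y x)).
Proof. by rewrite /dot3 /dot2; measurability. Qed.

Let ihc x : (leb3 R).-integrable setT
  (EFin \o (fun y => h y * cos (2 * pi * dot3 y x))).
Proof.
apply: (integrable_bounded ih (mcos x) (N := 1)) => y.
by rewrite ler_norml cos_geN1 cos_le1.
Qed.

Let ihs x : (leb3 R).-integrable setT
  (EFin \o (fun y => h y * sin (2 * pi * dot3 y x))).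
Proof.
apply: (integrable_bounded ih (msin x) (N := 1)) => y.
by rewrite ler_norml sin_geN1 sin_le1.
Qed.

Let phaseD (z : R3 R * R3 R) (x : R3 R) :
  2 * pi * dot3 (z.1 + z.2) x = 2 * pi * dot3 z.1 x + 2 * pi * dot3 z.2 x.
Proof. by rewrite /dot3 /dot2 /=; ring. Qed.

(** This and [squared_sin] are the real and imaginary parts of the square of
    the Fourier transform of h: the phases of the two factors add up to that
    of z.1 + z.2. *)
Lemma squared_cos x :
  \int[leb6 R]_z (h z.1 * h z.2 * cos (2 * pi * dot3 (z.1 + z.2) x)) =
    C x ^+ 2 - S x ^+ 2.
Proof.
rewrite !expr2 -!Rintegral_tensor// -RintegralB//; last 2 first.
- exact: (integrable_tensor (ihc x) (ihc x)).
- exact: (integrable_tensor (ihs x) (ihs x)).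
by apply: eq_Rintegral => z _; rewrite phaseD cosD; ring.
Qed.

Lemma squared_sin x :
  \int[leb6 R]_z (h z.1 * h z.2 * sin (2 * pi * dot3 (z.1 + z.2) x)) =
    2 * (C x * S x).
Proof.
rewrite (_ : 2 * (C x * S x) = C x * S x + S x * C x); last by ring.
rewrite -!Rintegral_tensor// -RintegralD//; last 2 first.
- exact: (integrable_tensor (ihc x) (ihs x)).
- exact: (integrable_tensor (ihs x) (ihc x)).
by apply: eq_Rintegral => z _; rewrite phaseD sinD; ring.
Qed.

(** In the variables z.1 and s = z.1 + z.2 the integrand is K (y - s) times
    the indicator of the intersection of D and s - D; the latter has measure
    at most M, and K has mass 1. *)
Lemma sumset_kernel_mass (y : R3 R) :
  (\int[leb6 R]_z (\1_(D `*` D) z * K (y - (z.1 + z.2)))%:E <= M%:E)%E.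
Proof.
have mK := measurable_kernel3 l0.
have M0 : (0 <= M%:E)%E.
  by apply: le_trans (DM 0); apply: integral_ge0 => c _;
    rewrite lee_fin mulr_ge0.
rewrite (_ : (\int[leb6 R]_z _)%E =
  (\int[(leb3 R \x leb3 R)%E]_z
    (\1_D z.1 * (\1_D z.2 * K (y - (z.1 + z.2))))%:E)%E); last first.
  apply: eq_integral => z _; rewrite mulrA; congr (_ * _)%:E.
  rewrite !indicE in_setX; by case: (_ \in _); case: (_ \in _);
    rewrite ?mulr0 ?mul0r ?mulr1.
rewrite fubini_tonelli1/=; last 2 first.
- by measurability.
- by move=> z; rewrite lee_fin; apply: mulr_ge0 => //; apply: mulr_ge0 => //;
  exact: kernel3_ge0.
rewrite /fubini_F /=.
have K0 u : (0 <= K u) by exact: kernel3_ge0.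
have mKy : measurable_fun setT (fun s : R3 R => K (y - s)) by measurability.
have mf : measurable_fun setT (fun z : R3 R * R3 R =>
    (\1_D z.1 * (\1_D (z.2 - z.1) * K (y - z.2)))%:E) by measurability.
have E c : (\int[leb3 R]_d (\1_D c * (\1_D d * K (y - (c + d))))%:E =
    \int[leb3 R]_s (\1_D c * (\1_D (s - c) * K (y - s)))%:E)%E.
  rewrite -(@ge0_integral_leb3_translation _
    (fun d => (\1_D c * (\1_D d * K (y - (c + d))))%:E) (- c)).
  - by apply: eq_integral => s _; rewrite [c + _]addrCA subrr addr0.
  - by measurability.
  - by move=> z; rewrite lee_fin; apply: mulr_ge0 => //; apply: mulr_ge0.
under eq_integral => c _ do rewrite E.
rewrite (fubini_tonelli (fun z : R3 R * R3 R =>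
    (\1_D z.1 * (\1_D (z.2 - z.1) * K (y - z.2)))%:E))//; last first.
  by move=> z; rewrite lee_fin; apply: mulr_ge0 => //; apply: mulr_ge0.
have DD s : measurable_fun setT (fun c : R3 R => \1_D c * \1_D (s - c) : R)
  by measurability.
apply: (@le_trans _ _ (\int[leb3 R]_s ((K (y - s))%:E * M%:E))%E).
  apply: ge0_le_integral_pointwise => s.
    by apply: integral_ge0 => c _; rewrite lee_fin; apply: mulr_ge0 => //;
      apply: mulr_ge0.
  have Kys : (0 <= (K (y - s))%:E)%E by rewrite lee_fin.
  apply: le_trans (lee_wpmul2l Kys (DM s)).
  rewrite -ge0_integralZl//; last by measurability.
  rewrite le_eqVlt; apply/orP; left; apply/eqP; apply: eq_integral => c _.
  by rewrite -EFinM /=; congr EFin; rewrite mulrA mulrC.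
rewrite ge0_integralZr//; last 2 first.
- by measurability.
- by move=> s _; rewrite lee_fin.
rewrite (_ : (\int[leb3 R]_x _)%E = 1%E) ?mul1e//.
rewrite -(integral_kernel3 l0) -(@ge0_integral_leb3_translation _ (fun s =>
  (K s)%:E) (- y)).
- by apply: eq_integral => s _; rewrite -[y - s]opprB kernel3N.
- by measurability.
- by move=> s; rewrite lee_fin.
Qed.

(** This is [bessel_inequality] for g (a, b) = h (a) h (b) and the frequency a
    + b, because (C^2 - S^2)^2 + (2 C S)^2 = (C^2 + S^2)^2. *)
Lemma fourier_L4_bilinear :
  (\int[leb3 R]_x (W x * (C x ^+ 2 + S x ^+ 2) ^+ 2)%:E <=
   M%:E * (\int[leb3 R]_y (h y ^+ 2)%:E * \int[leb3 R]_y (h y ^+ 2)%:E))%E.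
Proof.
have mth : measurable_fun setT (fun z : R3 R * R3 R => z.1 + z.2 : R3 R)
  by measurability.
have ig : (leb6 R).-integrable setT (EFin \o (fun z => h z.1 * h z.2)).
  exact: (integrable_tensor ih ih).
have mDD : measurable (D `*` D) by exact: measurableX.
have gE z : h z.1 * h z.2 = h z.1 * h z.2 * \1_(D `*` D) z.
  rewrite {1}(hD z.1) {1}(hD z.2) !indicE in_setX.
  by case: (_ \in D); case: (_ \in D); rewrite /= ?(mulr0, mul0r, mulr1).
have := bessel_inequality l0 ig mth mDD gE sumset_kernel_mass.
under eq_integral => x _.
  rewrite squared_cos squared_sin.
  rewrite (_ : _ * _ = W x * (C x ^+ 2 + S x ^+ 2) ^+ 2); last by ring.
  over.
move=> /le_trans; apply; rewrite le_eqVlt; apply/orP; left; apply/eqP;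
  congr (_ * _)%E.
rewrite /leb6 fubini_tonelli1/=; last 2 first.
- by measurability.
- by move=> z; rewrite lee_fin sqr_ge0.
rewrite /fubini_F /= -ge0_integralZr//; last 3 first.
- by measurability.
- by move=> x _; rewrite lee_fin sqr_ge0.
- by apply: integral_ge0 => x _; rewrite lee_fin sqr_ge0.
apply: eq_integral => x _; rewrite -ge0_integralZl//; last 3 first.
- by measurability.
- by move=> y _; rewrite lee_fin sqr_ge0.
- by rewrite lee_fin sqr_ge0.
by apply: eq_integral => y _; rewrite exprMn EFinM.
Qed.

End bilinear.

(** * The tube around the hyperbolic paraboloid *)

Section tube.
Context {R : realType}.
Local Notation leb := (@lebesgue_measure R).

(** For 0 < e < 1 this set contains the neighborhood of the surface, by
    [nbhd3_sub_tube], and its vertical sections are intervals. *)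
Definition tube (e : R) : set (R3 R) :=
  [set x | [/\ `|x.1.1| <= 2, `|x.1.2| <= 2 & `|x.2 - x.1.1 * x.1.2| <= 4 * e]].

Lemma measurable_tube e : measurable (tube e).
Proof.
rewrite (_ : tube e = [set x | `|x.1.1| <= 2] `&` [set x | `|x.1.2| <= 2] `&`
   [set x | `|x.2 - x.1.1 * x.1.2| <= 4 * e]); last first.
  by apply/seteqP; split => x /=; [case|case=> [[]]].
by apply: measurableI; [apply: measurableI|]; apply: measurable_ler_set;
  measurability.
Qed.

Let J (a r x : R) : R := (`|x - a| <= r)%R%:R.

Let mJ (a r : R) : measurable_fun [set: mR R] (J a r).
Proof.
rewrite (_ : J a r = \1_[set x : mR R | `|x - a| <= r]); last first.
  by apply/funext => x; rewrite indicE /J mem_setE.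
by apply: measurable_indic; apply: measurable_ler_set; measurability.
Qed.

Lemma integral_interval_indicator (a r : R) : 0 <= r ->
  (\int[leb]_x ((`|x - a| <= r)%R%:R : R)%:E = (2 * r)%:E)%E.
Proof.
move=> r0; transitivity (\int[leb]_x (\1_`[a - r, a + r] x)%:E)%E.
  apply: eq_integral => x _; rewrite indicE; congr (_%:R)%:E.
  by rewrite mem_setE in_itv /= ler_distl.
rewrite integral_indic// setIT.
have /= -> := @lebesgue_measure_itv R `[a - r, a + r]; rewrite lte_fin.
case: ltP => [_|h]; first by rewrite -EFinB; congr EFin; ring.
have -> : r = 0 by lra.
by rewrite mulr0.
Qed.

Lemma measurable_log_kernel (e : R) : 0 < e ->
  measurable_fun [set: mR R] (fun u : mR R =>
    (`|u| <= 2)%R%:R / (e + 2 * `|u|) : R).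
Proof.
move=> e0.
have d0 (u : R) : 0 < e + 2 * `|u| by rewrite ltr_pwDl // mulr_ge0.
apply: measurable_mulr.
    by have := mJ 0 2; apply: eq_measurable_fun => x _; rewrite /J subr0.
  apply: continuous_measurable_fun => x; apply: cvgV; first by rewrite gt_eqF.
  apply: cvgD; first exact: cvg_cst.
  by apply: cvgMr; exact: norm_continuous.
Qed.

(** The origin of the logarithmic loss. *)
Lemma integral_log_kernel (e : R) : 0 < e ->
  (\int[leb]_u ((`|u| <= 2)%R%:R / (e + 2 * `|u|))%:E =
    (ln ((e + 4) / e))%:E)%E.
Proof.
move=> e0.
have d0 (u : R) : 0 < e + 2 * `|u| by rewrite ltr_pwDl // mulr_ge0.
have m := measurable_log_kernel e0.
rewrite ge0_integral_symm; last 2 first.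
- exact: measurable_EFin_comp.
- by move=> u; rewrite lee_fin divr_ge0 // ltW.
under [X in (_ + X)%E]eq_integral do rewrite normrN.
have -> : (\int[leb]_(u in `[0%R, +oo[) ((`|u| <= 2)%R%:R / (e + 2 * `|u|))%:E =
    \int[leb]_(u in `[0%R, 2%R]) ((e + 2 * u)^-1)%:E)%E.
  rewrite [LHS]integral_mkcond [RHS]integral_mkcond; apply: eq_integral => u _.
  rewrite !patchE !mem_setE !in_itv /= andbT.
  case: (leP 0 u) => //= u0; rewrite ger0_norm //.
  by case: (leP u 2) => _; rewrite ?mul1r ?mul0r.
have p (u : R) : 0 <= u -> 0 < e + 2 * u by move=> u0;
  rewrite ltr_pwDl // mulr_ge0.
have D (u : R) : 0 <= u ->
  is_derive u 1 (fun x => 2^-1 * ln (e + 2 * x)) (e + 2 * u)^-1.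
  move=> u0; have := p _ u0 => h.
  have h1 := is_derive1_ln h.
  have h2 : is_derive u 1 (fun x => e + 2 * x) 2.
    by apply: is_derive_eq; rewrite /GRing.scale /=; ring.
  have h3 := @is_derive1_comp R (@ln R) (fun x => e + 2 * x) u _ _ h1 h2.
  have : is_derive u 1 (2^-1 *: (@ln R \o (fun x => e + 2 * x)))
    (2^-1 *: ((e + 2 * u)^-1 * 2)).
    exact: is_deriveZ.
  by rewrite /GRing.scale /= mulrC mulfK.
have cln (u : R) : 0 <= u ->
  {for u, continuous (fun x : R => (2^-1 * ln (e + 2 * x) : R))}.
  by move=> u0; apply: differentiable_continuous; apply/derivable1_diffP;
    case: (D u u0).
rewrite (@continuous_FTC2 _ _ (fun x => 2^-1 * ln (e + 2 * x)))//.
- rewrite -EFinB -EFinD mulr0 addr0; congr EFin.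
  rewrite ln_div ?posrE//; last lra.
  rewrite (_ : e + 2 * 2 = e + 4); last ring.
  lra.
- apply: derivable_within_continuous => u; rewrite in_itv /= => /andP[u0 _].
  apply: derivableV; first by rewrite gt_eqF // p.
  by [].
- split.
  + by move=> u; rewrite in_itv /= => /andP[/ltW u0 _]; case: (D u u0).
  + by apply: cvg_at_right_filter; exact: cln.
  + by apply: cvg_at_left_filter; exact: cln.
- by move=> u; rewrite in_itv /= => /andP[/ltW u0 _]; rewrite derive1E;
  case: (D u u0).
Qed.

(** If |a| <= e, the measure is at most that of the whole interval; otherwise
    y is confined to an interval of length 16 e / |a| around b / a. *)
Lemma integral_strip_section (e a b : R) : 0 < e ->
  (\int[leb]_y ((`|y| <= 2)%R%:R * (`|b - a * y| <= 8 * e)%R%:R : R)%:E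
    <= (32 * e / (e + `|a|))%:E)%E.
Proof.
move=> e0; have d0 : 0 < e + `|a| by rewrite ltr_pwDl.
case: (leP `|a| e) => ae.
  apply: (@le_trans _ _ (2 * 2)%:E); last first.
    by rewrite lee_fin ler_pdivlMr //; nra.
  rewrite -(integral_interval_indicator 0) //.
  apply: ge0_le_integral_pointwise => y;
    first by rewrite lee_fin mulr_ge0 ?ler0n.
  by rewrite lee_fin subr0 ler_piMr ?ler0n // lern1 leq_b1.
have a0 : a != 0 by rewrite -normr_gt0 (lt_trans e0).
apply: (@le_trans _ _ (2 * (8 * e / `|a|))%:E); last first.
  rewrite lee_fin ler_pdivlMr //.
  rewrite (_ : 2 * (8 * e / `|a|) * (e + `|a|) = 16 * e + 16 * e * (e / `|a|));
    last first.
    by field; rewrite normr_eq0.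
  have : e / `|a| <= 1 by rewrite ler_pdivrMr ?mul1r ?normr_gt0 // ltW.
  nra.
rewrite -(integral_interval_indicator (b / a)); last first.
  by rewrite divr_ge0 // mulr_ge0 // ltW.
apply: ge0_le_integral_pointwise => y; first by rewrite lee_fin mulr_ge0 ?ler0n.
rewrite lee_fin (_ : (`|y - b / a| <= _) = (`|b - a * y| <= 8 * e)); last first.
  rewrite ler_pdivlMr ?normr_gt0 // -normrM distrC.
  by congr (`|_| <= _); field.
by rewrite ler_piMl ?ler0n // lern1 leq_b1.
Qed.

(** The conditions on the last coordinates of x and s - x add up to a
    condition on x1 x2 + (s1 - x1) (s2 - x2), which is affine in x2 of slope 2
    x1 - s1. *)
Lemma tube_sumset_fiber (e : R) (s x : R3 R) : 0 < e ->
  \1_(tube e) x * \1_(tube e) (s - x) <=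
  (`|x.1.1 - s.1.1 / 2| <= 2)%R%:R *
  ((`|x.1.2| <= 2)%R%:R *
    (`|s.2 - (s.1.1 - x.1.1) * s.1.2 - (2 * x.1.1 - s.1.1) * x.1.2| <=
    8 * e)%R%:R) *
  (`|x.2 - x.1.1 * x.1.2| <= 4 * e)%R%:R :> R.
Proof.
move=> e0; rewrite !indicE.
case: (boolP (x \in _)); last by rewrite mul0r !mulr_ge0 ?ler0n.
move=> /set_mem[h1 h2 h3].
case: (boolP (s - x \in _)); last by rewrite mulr0 !mulr_ge0 ?ler0n.
move=> /set_mem[/= k1 k2 k3].
rewrite (_ : `|x.1.1 - s.1.1 / 2| <= 2); last first.
  move: h1 k1; rewrite !ler_norml => /andP[? ?] /andP[? ?]; apply/andP; split;
    lra.
rewrite h2 h3 (_ : `|s.2 - _ - _| <= _) ?mul1r //.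
move: h3 k3; rewrite !ler_norml => /andP[? ?] /andP[? ?]; apply/andP; split;
  lra.
Qed.

(** The three factors of [tube_sumset_fiber] are integrated in x3, then x2,
    then x1. The slope 2 x1 - s1 vanishes to first order at a single point,
    hence the logarithm. *)
Lemma tube_sumset (e : R) (s : R3 R) : 0 < e ->
  (\int[leb3 R]_x (\1_(tube e) x * \1_(tube e) (s - x))%:E <=
   (256 * e ^+ 2 * ln ((e + 4) / e))%:E)%E.
Proof.
move=> e0; have mt := measurable_tube e.
have m1 : measurable_fun setT (\1_(tube e) : R3 R -> R)
  by exact: measurable_indic.
rewrite ge0_integral_leb3; last 2 first.
- by measurability.
- by move=> x; rewrite lee_fin mulr_ge0.
pose a (x : R) : R := (`|x - s.1.1 / 2| <= 2)%R%:R.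
pose b (x y : R) : R := (`|y| <= 2)%R%:R *
  (`|s.2 - (s.1.1 - x) * s.1.2 - (2 * x - s.1.1) * y| <= 8 * e)%R%:R.
have b0 x y : 0 <= b x y by rewrite mulr_ge0 ?ler0n.
have a0 x : 0 <= a x by rewrite ler0n.
have L (u v : R) : measurable_fun [set: mR R] (fun z : mR R =>
  (`|u - v * z| <= 8 * e)%R%:R : R).
  rewrite (_ : (fun _ => _) = \1_[set z : mR R | `|u - v * z| <= 8 * e]);
    last first.
    by apply/funext => x; rewrite indicE mem_setE.
  by apply: measurable_indic; apply: measurable_ler_set; measurability.
have mb x : measurable_fun [set: mR R] (b x).
  have m0 := mJ 0 2; have m2 := L (s.2 - (s.1.1 - x) * s.1.2) (2 * x - s.1.1).
  rewrite /b; apply: measurable_mulr => //.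
  by apply: eq_measurable_fun m0 => y _; rewrite /J subr0.
have s3 x y : (\int[leb]_z
  (\1_(tube e) (x, y, z) * \1_(tube e) (s - (x, y, z)))%:E <=
    (a x * b x y * (8 * e))%:E)%E.
  rewrite (_ : 8 * e = 2 * (4 * e)); last ring.
  rewrite EFinM -(integral_interval_indicator (x * y));
    last by rewrite mulr_ge0 // ltW.
  rewrite -ge0_integralZl//; last 2 first.
  - by apply: measurable_EFin_comp; exact: mJ.
  - by rewrite lee_fin mulr_ge0.
  apply: ge0_le_integral_pointwise => z; first by rewrite lee_fin mulr_ge0.
  by rewrite -EFinM lee_fin; exact: (tube_sumset_fiber s (x, y, z) e0).
have s2 x : (\int[leb]_y \int[leb]_z
  (\1_(tube e) (x, y, z) * \1_(tube e) (s - (x, y, z)))%:E <=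
    (256 * e ^+ 2 * (a x / (e + `|2 * x - s.1.1|)))%:E)%E.
  apply: (@le_trans _ _ (\int[leb]_y ((8 * e * a x)%:E * (b x y)%:E))%E).
    apply: ge0_le_integral_pointwise => y; first by apply: integral_ge0 => z _;
      rewrite lee_fin mulr_ge0.
    by apply: le_trans (s3 x y) _; rewrite -EFinM lee_fin; lra.
  have c0 : (0 <= (8 * e * a x)%:E)%E
    by rewrite lee_fin mulr_ge0 // mulr_ge0 // ltW.
  rewrite ge0_integralZl//; last 2 first.
  - exact: measurable_EFin_comp.
  - by move=> y _; rewrite lee_fin.
  apply: le_trans (lee_wpmul2l c0 (integral_strip_section _ _ e0)) _.
  rewrite -EFinM lee_fin le_eqVlt; apply/orP; left; apply/eqP; ring.
have c0 : 0 <= 256 * e ^+ 2 by rewrite mulr_ge0 // sqr_ge0.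
rewrite EFinM -(integral_log_kernel e0).
rewrite -(@ge0_integral_translation _ (fun u =>
  ((`|u| <= 2)%R%:R / (e + 2 * `|u|))%:E) (- (s.1.1 / 2))).
- rewrite -ge0_integralZl//.
  + apply: ge0_le_integral_pointwise => x.
      by apply: integral_ge0 => y _; apply: integral_ge0 => z _;
        rewrite lee_fin mulr_ge0.
    apply: le_trans (s2 x) _; rewrite -EFinM lee_fin ler_wpM2l //.
    rewrite /a (_ : 2 * `|x - s.1.1 / 2| = `|2 * x - s.1.1|) //.
    by rewrite -{1}(@ger0_norm R 2) // -normrM; congr `|_|; field.
  + apply: (measurableT_comp
    (measurable_EFin_comp (measurable_log_kernel e0))); measurability.
  + by move=> x _; rewrite lee_fin divr_ge0 // addr_ge0 ?mulr_ge0 // ltW.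
- exact: (measurable_EFin_comp (measurable_log_kernel e0)).
- by move=> x; rewrite lee_fin divr_ge0 // addr_ge0 ?mulr_ge0 // ltW.
Qed.

Lemma tube_volume (e : R) : 0 < e ->
  (\int[leb3 R]_x (\1_(tube e) x)%:E <= (128 * e)%:E)%E.
Proof.
move=> e0; have mt := measurable_tube e.
have m1 : measurable_fun setT (\1_(tube e) : R3 R -> R)
  by exact: measurable_indic.
rewrite ge0_integral_leb3; last 2 first.
- by measurability.
- by move=> x; rewrite lee_fin.
have I2 : (\int[leb]_y ((`|y| <= 2)%R%:R : R)%:E = 4%:E)%E.
  transitivity (2 * 2 : R)%:E; last by congr EFin; ring.
  rewrite -(integral_interval_indicator 0) //.
  by apply: eq_integral => y _; rewrite subr0.
have m2 : measurable_fun [set: mR R] (fun y : mR R => (`|y| <= 2)%R%:R : R).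
  by have := mJ 0 2; apply: eq_measurable_fun => y _; rewrite /J subr0.
have s3 x y : (\int[leb]_z (\1_(tube e) (x, y, z))%:E <=
    ((`|x| <= 2)%R%:R * (`|y| <= 2)%R%:R * (8 * e))%:E)%E.
  rewrite (_ : 8 * e = 2 * (4 * e)); last ring.
  rewrite EFinM -(integral_interval_indicator (x * y));
    last by rewrite mulr_ge0 // ltW.
  rewrite -ge0_integralZl//; last by apply: measurable_EFin_comp; exact: mJ.
  apply: ge0_le_integral_pointwise => z; first by rewrite lee_fin.
  rewrite -EFinM lee_fin indicE.
  case: (boolP (_ \in _)); last by rewrite !mulr_ge0 ?ler0n.
  by move=> /set_mem[/= -> -> ->]; rewrite !mul1r.
apply: (@le_trans _ _ (\int[leb]_x \int[leb]_y
  (((`|x| <= 2)%R%:R * (8 * e))%:E * ((`|y| <= 2)%R%:R : R)%:E))%E).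
  apply: ge0_le_integral_pointwise => x.
    by apply: integral_ge0 => y _; apply: integral_ge0 => z _; rewrite lee_fin.
  apply: ge0_le_integral_pointwise => y; first by apply: integral_ge0 => z _;
    rewrite lee_fin.
  by apply: le_trans (s3 x y) _; rewrite -EFinM lee_fin mulrAC.
under eq_integral => x _.
  rewrite ge0_integralZl//; last 2 first.
  - exact: measurable_EFin_comp.
  - by rewrite lee_fin mulr_ge0 // mulr_ge0 // ltW.
  rewrite I2 -EFinM -mulrA EFinM muleC.
  over.
rewrite ge0_integralZl//; last 2 first.
- exact: measurable_EFin_comp.
- by rewrite lee_fin mulr_ge0 // mulr_ge0 // ltW.
rewrite I2 -EFinM lee_fin le_eqVlt; apply/orP; left; apply/eqP; ring.
Qed.

End tube.

(** * Real functions supported in the tube *)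

Section real_function.
Context {R : realType} (e : R) (e0 : 0 < e).
Variables (h : R3 R -> R) (q : R).
Hypotheses (mh : measurable_fun setT h)
  (ht : forall x, h x = h x * \1_(tube e) x).
Hypothesis hq : (\int[leb3 R]_x (h x ^+ 2)%:E = q%:E)%E.

Let mt := measurable_tube e.
Let m1 : measurable_fun setT (\1_(tube e) : R3 R -> R).
Proof. exact: measurable_indic. Qed.

Let i1 : (leb3 R).-integrable setT (EFin \o (\1_(tube e) : R3 R -> R)).
Proof.
apply/integrableP; split; first exact: measurable_EFin_comp.
under eq_integral => x _ do rewrite /= ger0_norm//.
exact: le_lt_trans (tube_volume e0) (ltry _).
Qed.

Let i2 : (leb3 R).-integrable setT (EFin \o (fun x => h x ^+ 2)).
Proof.
apply/integrableP; split; first by apply: measurable_EFin_comp; measurability.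
under eq_integral => x _ do rewrite /= ger0_norm ?sqr_ge0//.
by rewrite hq ltry.
Qed.

(** The tube has finite measure and |h| <= 1 + h^2. *)
Lemma integrable_tube_supported : (leb3 R).-integrable setT (EFin \o h).
Proof.
have i3 : (leb3 R).-integrable setT
  (EFin \o (fun x => \1_(tube e) x + h x ^+ 2)).
  exact: (integrableD measurableT i1 i2).
apply: (le_integrable measurableT _ _ i3); first exact: measurable_EFin_comp.
move=> x _ /=; rewrite lee_fin [leRHS]ger0_norm;
  last by rewrite addr_ge0 ?sqr_ge0.
rewrite (ht x) indicE; case: (_ \in _);
  last by rewrite mulr0 normr0 add0r sqr_ge0.
rewrite mulr1n mulr1 -[h x ^+ 2]real_normK ?num_real //.
by have := sqr_ge0 (`|h x| - 2^-1); lra.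
Qed.
Local Notation ih := integrable_tube_supported.

(** The Cauchy-Schwarz inequality, from the nonnegativity of the integral of
    (|h| - t)^2 over the tube at the optimal t. *)
Lemma L1_le_L2 : (\int[leb3 R]_x `|h x|) ^+ 2 <= 128 * e * q.
Proof.
set I := \int[leb3 R]_x `|h x|.
have v0 : 0 < 128 * e by rewrite mulr_gt0.
have main t : 2 * t * I <= q + t ^+ 2 * (128 * e).
  have ia : (leb3 R).-integrable setT (EFin \o (fun x => (2 * t) * `|h x|)).
    exact: (integrableZl measurableT (2 * t) (integrable_norm ih)).
  have ib : (leb3 R).-integrable setT
    (EFin \o (fun x => t ^+ 2 * \1_(tube e) x)).
    exact: (integrableZl measurableT (t ^+ 2) i1).
  rewrite /I -RintegralZl//; last exact: (integrable_norm ih).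
  apply: (@le_trans _ _ (\int[leb3 R]_x (h x ^+ 2 + t ^+ 2 * \1_(tube e) x))).
    apply: le_Rintegral => //; first exact: (integrableD measurableT i2 ib).
    move=> x _; rewrite (ht x) indicE; case: (_ \in _); last first.
      by rewrite !mulr0 normr0 mulr0 expr0n addr0.
    rewrite mulr1n !mulr1 -[h x ^+ 2]real_normK ?num_real //.
    by have := sqr_ge0 (`|h x| - t); lra.
  rewrite RintegralD// RintegralZl// lerD//.
    by rewrite /Rintegral hq.
  rewrite ler_wpM2l ?sqr_ge0// /Rintegral -lee_fin fineK ?tube_volume//.
  exact: integrable_fin_num.
(* 128 e bounds the measure of the tube. *)
have := main (I / (128 * e)).
rewrite (_ : 2 * (I / (128 * e)) * I = 2 * (I ^+ 2 / (128 * e)));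
  last by field; rewrite gt_eqF.
rewrite (_ : (I / (128 * e)) ^+ 2 * (128 * e) = I ^+ 2 / (128 * e));
  last by field; rewrite gt_eqF.
move=> H; have : I ^+ 2 / (128 * e) <= q by lra.
by rewrite ler_pdivrMr // mulrC.
Qed.

Let C (x : R3 R) := \int[leb3 R]_y (h y * cos (2 * pi * dot3 y x)).
Let S (x : R3 R) := \int[leb3 R]_y (h y * sin (2 * pi * dot3 y x)).

Let bounded (b : R3 R -> R) : measurable_fun setT b ->
  (forall y, `|b y| <= 1) ->
  (\int[leb3 R]_y (h y * b y)) ^+ 2 <= 128 * e * q.
Proof.
move=> mb b1; have ihb := integrable_bounded ih mb b1.
apply: le_trans L1_le_L2; rewrite -[leLHS]real_normK ?num_real //.
rewrite ler_pXn2r // ?nnegrE ?Rintegral_ge0 //.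
apply: le_trans (le_normr_Rintegral measurableT ihb) _.
apply: le_Rintegral => //.
- exact: (integrable_norm ihb).
- exact: (integrable_norm ih).
- by move=> y _; rewrite normrM ler_piMr.
Qed.

Lemma fourier_cos_sin_bounded x : C x ^+ 2 + S x ^+ 2 <= 256 * e * q.
Proof.
rewrite (_ : 256 * e * q = 128 * e * q + 128 * e * q); last ring.
apply: lerD; apply: bounded; rewrite /dot3 /dot2; try by measurability.
- by move=> y; rewrite ler_norml cos_geN1 cos_le1.
- by move=> y; rewrite ler_norml sin_geN1 sin_le1.
Qed.

Lemma fourier_cos_sin_L4 (l : R) : 0 < l ->
  (\int[leb3 R]_x (weight3 l x * (C x ^+ 2 + S x ^+ 2) ^+ 2)%:E <=
   (256 * e ^+ 2 * ln ((e + 4) / e) * q ^+ 2)%:E)%E.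
Proof.
move=> l0; have := fourier_L4_bilinear l0 ih mt ht (fun s => tube_sumset s e0).
by rewrite hq -!EFinM -expr2.
Qed.

Lemma measurable_fourier_cos : measurable_fun setT C.
Proof.
apply: (measurable_parameter_Rintegral (leb3 R) (f := fun z =>
  h z.1 * cos (2 * pi * dot3 z.1 z.2))).
by rewrite /dot3 /dot2; measurability.
Qed.

Lemma measurable_fourier_sin : measurable_fun setT S.
Proof.
apply: (measurable_parameter_Rintegral (leb3 R) (f := fun z =>
  h z.1 * sin (2 * pi * dot3 z.1 z.2))).
by rewrite /dot3 /dot2; measurability.
Qed.

End real_function.

(** * Neighborhoods and balls *)

Section geometry.
Context {R : realType}.

Lemma norm3_coord (x : R * R * R) :
  [/\ `|x.1.1| <= norm3 x, `|x.1.2| <= norm3 x & `|x.2| <= norm3 x].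
Proof.
have sq (a : R) : 0 <= a * a by rewrite -expr2 sqr_ge0.
by split; rewrite /norm3 /dot3 /dot2 -sqrtr_sqr ler_wsqrtr // expr2;
  have := sq x.1.1; have := sq x.1.2; have := sq x.2; lra.
Qed.

(** For a point (z1, z2, z1 z2) of the surface at distance less than e of x,
    the difference x3 - x1 x2 is the sum of x3 - z1 z2, (z1 - x1) z2 and x1
    (z2 - x2), of sizes e, e and 2 e. *)
Lemma nbhd3_sub_tube (e : R) : 0 < e < 1 ->
  nbhd3 e (@hyp_paraboloid R) `<=` tube e.
Proof.
move=> /andP[e0 e1] x [y [z [/=]]].
rewrite !in_itv /= => /andP[z1 z1'] /andP[z2 z2'] <- {y}.
have [] := norm3_coord (x - (z, phi z)); rewrite /phi /=.
move=> h1 h2 h3 xe.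
have {}h1 := le_lt_trans h1 xe; have {}h2 := le_lt_trans h2 xe;
  have {}h3 := le_lt_trans h3 xe.
move: h1 h2 h3; rewrite !ltr_norml => /andP[? ?] /andP[? ?] /andP[? ?].
split=> /=.
- by rewrite ler_norml; apply/andP; split; lra.
- by rewrite ler_norml; apply/andP; split; lra.
- rewrite (_ : x.2 - x.1.1 * x.1.2 = (x.2 - z.1 * z.2) - (x.1.1 - z.1)
  * z.2 - x.1.1 * (x.1.2 - z.2)); last ring.
  apply: (le_trans (ler_normB _ _)).
  have b3 : `|x.1.1 * (x.1.2 - z.2)| <= 2 * e.
    rewrite normrM; apply: ler_pM => //; rewrite ler_norml; apply/andP; split;
      lra.
  have b2 : `|(x.1.1 - z.1) * z.2| <= e * 1.
    rewrite normrM; apply: ler_pM => //; rewrite ler_norml; apply/andP; split;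
      lra.
  have b1 : `|x.2 - z.1 * z.2| <= e.
    rewrite ler_norml; apply/andP; split; lra.
  have := ler_normB (x.2 - z.1 * z.2) ((x.1.1 - z.1) * z.2); lra.
Qed.

(** The coordinates of the points of the ball are at most 1 / l for a small l,
    and then each of the three exponents is at least -1. *)
Lemma ball3_weight (c : R * R * R) (r : R) : exists2 l : R, 0 < l &
  forall x, ball3 c r x -> expR (- 3) <= weight3 l x.
Proof.
pose k := norm3 c + `|r| + 1.
have k0 : 0 < k by rewrite ltr_wpDl // addr_ge0 // /norm3 sqrtr_ge0.
exists k^-1; first by rewrite invr_gt0.
move=> x xB; rewrite /ball3 /= in xB.
have [h1 h2 h3] := norm3_coord (x - c).
have [c1 c2 c3] := norm3_coord c.
have K (a b : R) : `|a - b| <= norm3 (x - c) -> `|b| <= norm3 c ->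
  expR (- 1) <= laplace_weight k^-1 a.
  move=> hab hb; rewrite /laplace_weight ler_expR lerN2 mulrC ler_pdivrMr //
    mul1r.
  have := ler_normD (a - b) b; rewrite subrK /k.
  have := ler_norm r; lra.
rewrite /weight3 (_ : - 3 = - 1 - 1 - 1 :> R); last ring.
rewrite !expRD; apply: ler_pM; rewrite ?mulr_ge0 ?expR_ge0 //; last exact: K c3.
by apply: ler_pM; rewrite ?expR_ge0 //; [exact: K c1|exact: K c2].
Qed.

End geometry.

Lemma ae_imply d (T : measurableType d) (R : realType)
    (mu : {measure set T -> \bar R}) (P Q : T -> Prop) : (forall x, P x ->
      Q x) ->
  {ae mu, forall x, P x} -> {ae mu, forall x, Q x}.
Proof. by move=> PQ; apply: negligibleS => x nq p; apply: nq; exact: PQ. Qed.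

(** * Complex functions supported near the paraboloid *)

Section complex_function.
Context {R : realType} (e : R) (e01 : 0 < e < 1).
Variable F : R * R * R -> R[i].
Let N := nbhd3 e (@hyp_paraboloid R).
Hypotheses (LF : cLp (leb3 R) 2%:E N F)
  (F0 : {ae leb3 R, forall xi, ~ N xi -> F xi = 0}).

Let e0 : 0 < e. Proof. by case/andP: e01. Qed.

Let NT : N `<=` tube e. Proof. exact: nbhd3_sub_tube. Qed.

Let t : R3 R -> R := \1_(tube e).
Let mt : measurable_fun setT t.
Proof. by apply: measurable_indic; exact: measurable_tube. Qed.

Let mre : measurable_fun [set: R3 R] (fun x => complex.Re (F x)).
Proof. by case: LF => -[]. Qed.

Let mim : measurable_fun [set: R3 R] (fun x => complex.Im (F x)).
Proof. by case: LF => -[]. Qed.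

(* The real and imaginary parts of F, cut off to the tube; the cut-off changes
   them on a null set only. *)
Let F1 (x : R3 R) : R := complex.Re (F x) * t x.
Let F2 (x : R3 R) : R := complex.Im (F x) * t x.
Let m1 : measurable_fun setT F1. Proof. by rewrite /F1; measurability. Qed.

Let m2 : measurable_fun setT F2. Proof. by rewrite /F2; measurability. Qed.

Let tt (x : R3 R) : t x * t x = t x.
Proof. by rewrite /t indicE; case: (_ \in _); rewrite ?mulr1 ?mulr0. Qed.

Let s1 x : F1 x = F1 x * \1_(tube e) x.
Proof. by rewrite -/t /F1 -mulrA tt. Qed.

Let s2 x : F2 x = F2 x * \1_(tube e) x.
Proof. by rewrite -/t /F2 -mulrA tt. Qed.

Lemma cmod_sqr (z : R[i]) : cmod z ^+ 2 = complex.Re z ^+ 2 + complex.Im z ^+ 2.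
Proof. by case: z => a b; rewrite /cmod /= sqr_sqrtr // addr_ge0 ?sqr_ge0. Qed.

Lemma cmod_ge0 (z : R[i]) : 0 <= cmod z.
Proof. by case: z => a b; rewrite /cmod /= sqrtr_ge0. Qed.

(** The exceptional null set Z is first removed from the left-hand side; off Z
    the integrands are compared pointwise. *)
Lemma L2_mass : (\int[leb3 R]_x (F1 x ^+ 2 + F2 x ^+ 2)%:E <=
  (cLnorm (leb3 R) 2%:E N F) `^ 2)%E.
Proof.
rewrite /cLnorm poweR_Lnorm//.
have [Z [mZ Z0 FZ]] := F0.
have mz : measurable_fun setT (\1_(~` Z) : R3 R -> R).
  by apply: measurable_indic; exact: measurableC.
rewrite (_ : (\int[leb3 R]_x _)%E =
  (\int[leb3 R]_x ((F1 x ^+ 2 + F2 x ^+ 2) * \1_(~` Z) x)%:E)%E); last first.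
  apply: ge0_ae_eq_integral => //.
  - by measurability.
  - by measurability.
  - by move=> x _; rewrite lee_fin addr_ge0 ?sqr_ge0.
  - by move=> x _; rewrite lee_fin mulr_ge0 ?addr_ge0 ?sqr_ge0.
  - exists Z; split => // x /= nx; apply: contrapT => xZ; apply: nx => _.
    by rewrite indicE (_ : (x \in ~` Z) = true) ?mulr1 //; exact: mem_set.
apply: ge0_le_integral_pointwise => x.
  by rewrite lee_fin mulr_ge0 ?addr_ge0 ?sqr_ge0.
rewrite indicE; case: (boolP (x \in ~` Z)) => [/set_mem xZ|_]; last first.
  by rewrite mulr0 poweR_ge0.
have Fx : ~ N x -> F x = 0.
  by move=> nx; apply: contrapT => h; apply: xZ; apply: FZ => /= /(_ nx).
rewrite mulr1 patchE; case: ifPn => [_|/negP xN].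
  rewrite gee0_abs; last by rewrite lee_fin cmod_ge0.
  rewrite poweR_EFin lee_fin.
  rewrite -[2]/(2%:R) powR_mulrn ?cmod_ge0 // cmod_sqr /F1 /F2 !exprMn.
  have -> : t x ^+ 2 = t x by rewrite expr2 tt.
  rewrite -mulrDl ler_piMr ?addr_ge0 ?sqr_ge0 //.
  by rewrite /t indicE lern1 leq_b1.
rewrite /F1 /F2 Fx; last by move=> h; apply: xN; rewrite mem_set.
rewrite (_ : _ + _ = 0); first exact: poweR_ge0.
by rewrite /= !mul0r !expr0n addr0.
Qed.

Let C (h : R3 R -> R) (x : R3 R) := \int[leb3 R]_y
  (h y * cos (2 * pi * dot3 y x)).
Let S (h : R3 R -> R) (x : R3 R) := \int[leb3 R]_y
  (h y * sin (2 * pi * dot3 y x)).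

Lemma L2_parts : exists q1 q2 : R, [/\
  (\int[leb3 R]_x (F1 x ^+ 2)%:E = q1%:E)%E,
  (\int[leb3 R]_x (F2 x ^+ 2)%:E = q2%:E)%E &
  q1 + q2 <= fine (cLnorm (leb3 R) 2%:E N F) ^+ 2].
Proof.
set n := cLnorm _ _ _ _.
have n0 : (0 <= n)%E by exact: Lnorm_ge0.
have nfin : n \is a fin_num by rewrite ge0_fin_numE //; case: LF.
have p1 : (0 <= \int[leb3 R]_x (F1 x ^+ 2)%:E)%E.
  by apply: integral_ge0 => x _; rewrite lee_fin sqr_ge0.
have p2 : (0 <= \int[leb3 R]_x (F2 x ^+ 2)%:E)%E.
  by apply: integral_ge0 => x _; rewrite lee_fin sqr_ge0.
have := L2_mass; rewrite -/n -(fineK nfin) poweR_EFin -[2]/(2%:R)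
  powR_mulrn ?fine_ge0 //.
under eq_integral do rewrite EFinD.
rewrite ge0_integralD//; last 4 first.
- by move=> x _; rewrite lee_fin sqr_ge0.
- by measurability.
- by move=> x _; rewrite lee_fin sqr_ge0.
- by measurability.
move: p1 p2; case: (\int[leb3 R]_x (F1 x ^+ 2)%:E)%E => [q1| |] //; last first.
  by case: (\int[leb3 R]_x (F2 x ^+ 2)%:E)%E.
case: (\int[leb3 R]_x (F2 x ^+ 2)%:E)%E => [q2| |] // _ _.
by rewrite -EFinD lee_fin => h; exists q1, q2.
Qed.

Lemma fourier3E x : fourier3 F x = ((C F1 x + S F2 x) +i* (C F2 x - S F1 x))%C.
Proof.
have [q1 [q2 [h1 h2 _]]] := L2_parts.
have i1 := integrable_tube_supported e0 m1 s1 h1.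
have i2 := integrable_tube_supported e0 m2 s2 h2.
have mc : measurable_fun setT (fun y : R3 R => cos (2 * pi * dot3 y x)).
  by rewrite /dot3 /dot2; measurability.
have ms : measurable_fun setT (fun y : R3 R => sin (2 * pi * dot3 y x)).
  by rewrite /dot3 /dot2; measurability.
have bc (y : R3 R) : `|cos (2 * pi * dot3 y x)| <= 1
  by rewrite ler_norml cos_geN1 cos_le1.
have bs (y : R3 R) : `|sin (2 * pi * dot3 y x)| <= 1
  by rewrite ler_norml sin_geN1 sin_le1.
have F12 : {ae leb3 R, forall y,
  complex.Re (F y) = F1 y /\ complex.Im (F y) = F2 y}.
  move: F0; apply: ae_imply => y Fy; rewrite /F1 /F2 /t indicE.
  case: (boolP (y \in tube e)) => [_|/negP h]; first by rewrite !mulr1.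
  rewrite Fy /= ?mul0r // => yN; apply: h; apply: mem_set; exact: NT.
rewrite /fourier3 /cintegral; congr (_ +i* _)%C.
- rewrite /C /S -RintegralD//; last 2 first.
  + exact: (integrable_bounded i1 mc bc).
  + exact: (integrable_bounded i2 ms bs).
  congr fine; apply: ae_eq_integral => //.
  + apply: measurable_EFin_comp. rewrite (_ : (fun _ => _) = fun y : R3 R =>
    complex.Re (F y) * cos (2 * pi * dot3 y x) + complex.Im (F y) * sin
    (2 * pi * dot3 y x)).
      by measurability.
    apply/funext => y; case: (F y) => a b; rewrite /= cosN sinN; ring.
  + by measurability.
  + move: F12; apply: ae_imply => y [<- <-] _; congr EFin.
    case: (F y) => a b; rewrite /= cosN sinN; ring.
- rewrite /C /S -RintegralB//; last 2 first.
  + exact: (integrable_bounded i2 mc bc).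
  + exact: (integrable_bounded i1 ms bs).
  congr fine; apply: ae_eq_integral => //.
  + apply: measurable_EFin_comp. rewrite (_ : (fun _ => _) = fun y : R3 R =>
    complex.Im (F y) * cos (2 * pi * dot3 y x) - complex.Re (F y) * sin
    (2 * pi * dot3 y x)).
      by measurability.
    apply/funext => y; case: (F y) => a b; rewrite /= cosN sinN; ring.
  + by measurability.
  + move: F12; apply: ae_imply => y [<- <-] _; congr EFin.
    case: (F y) => a b; rewrite /= cosN sinN; ring.
Qed.

Let n := fine (cLnorm (leb3 R) 2%:E N F).

Lemma measurable_cmod_fourier3 : measurable_fun [set: R3 R] (fun x =>
  cmod (fourier3 F x) ^+ 4).
Proof.
have mc1 := measurable_fourier_cos m1; have ms1 := measurable_fourier_sin m1.
have mc2 := measurable_fourier_cos m2; have ms2 := measurable_fourier_sin m2.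
rewrite (_ : (fun _ => _) = fun x : R3 R =>
  ((C F1 x + S F2 x) ^+ 2 + (C F2 x - S F1 x) ^+ 2) ^+ 2).
  by rewrite /C /S; measurability.
by apply/funext => x; rewrite -[4%N]/(2 * 2)%N exprM cmod_sqr fourier3E.
Qed.

Let cmod_le x : cmod (fourier3 F x) ^+ 2 <=
  2 * ((C F1 x ^+ 2 + S F1 x ^+ 2) + (C F2 x ^+ 2 + S F2 x ^+ 2)).
Proof.
rewrite cmod_sqr fourier3E /=.
have := sqr_ge0 (C F1 x - S F2 x); have := sqr_ge0 (C F2 x + S F1 x); lra.
Qed.

(** By [cmod_le] and [fourier_cos_sin_bounded] the square of the left-hand
    side is at most 512 e n^2, and 512 <= 23^2. *)
Lemma fourier3_sup x : cmod (fourier3 F x) <= 23 * e `^ 2^-1 * n.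
Proof.
have [q1 [q2 [h1 h2 qn]]] := L2_parts.
have n0 : 0 <= n by apply: fine_ge0; exact: Lnorm_ge0.
have r0 : 0 <= 23 * e `^ 2^-1 * n by rewrite !mulr_ge0 ?powR_ge0.
rewrite -(@ler_pXn2r _ 2) ?nnegrE ?cmod_ge0 //.
apply: le_trans (cmod_le x) _.
have b1 := fourier_cos_sin_bounded e0 m1 s1 h1 x.
have b2 := fourier_cos_sin_bounded e0 m2 s2 h2 x.
rewrite !exprMn -[(e `^ _) ^+ 2]powR_mulrn ?powR_ge0 // -powRrM mulVf
  ?pnatr_eq0 // (powRr1 (ltW e0)).
have qn' : e * (q1 + q2) <= e * n ^+ 2 by rewrite ler_wpM2l // ltW.
have : 0 <= e * n ^+ 2 by rewrite mulr_ge0 ?sqr_ge0 // ltW.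
move: b1 b2; rewrite /C /S; lra.
Qed.

(** The fourth power of the modulus is at most 8 times the sum of the squares
    that [fourier_cos_sin_L4] bounds, and 2048 = 8 * 256. *)
Lemma fourier3_L4 (l : R) : 0 < l ->
  (\int[leb3 R]_x (weight3 l x * cmod (fourier3 F x) ^+ 4)%:E <=
   (2048 * e ^+ 2 * ln ((e + 4) / e) * n ^+ 4)%:E)%E.
Proof.
move=> l0; have [q1 [q2 [h1 h2 qn]]] := L2_parts.
have b1 := fourier_cos_sin_L4 e0 m1 s1 h1 l0.
have b2 := fourier_cos_sin_L4 e0 m2 s2 h2 l0.
have q10 : 0 <= q1 by rewrite -lee_fin -h1; apply: integral_ge0 => x _;
  rewrite lee_fin sqr_ge0.
have q20 : 0 <= q2 by rewrite -lee_fin -h2; apply: integral_ge0 => x _;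
  rewrite lee_fin sqr_ge0.
have mc1 := measurable_fourier_cos m1; have ms1 := measurable_fourier_sin m1.
have mc2 := measurable_fourier_cos m2; have ms2 := measurable_fourier_sin m2.
have mw := measurable_weight3 l.
have w0 := weight3_ge0 l.
pose Q h x := weight3 l x * (C h x ^+ 2 + S h x ^+ 2) ^+ 2.
have Q0 h x : (0 <= (Q h x)%:E)%E by rewrite lee_fin mulr_ge0 ?sqr_ge0.
have mQ1 : measurable_fun setT (fun x => (Q F1 x)%:E) by rewrite /Q /C /S;
  measurability.
have mQ2 : measurable_fun setT (fun x => (Q F2 x)%:E) by rewrite /Q /C /S;
  measurability.
have ln0 : 0 <= ln ((e + 4) / e) by rewrite ln_ge0 // ler_pdivlMr //; lra.
apply: (@le_trans _ _ (\int[leb3 R]_x (8%:E * ((Q F1 x)%:E + (Q F2 x)%:E)))%E).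
  apply: ge0_le_integral_pointwise => x;
    first by rewrite lee_fin mulr_ge0 // exprn_ge0 // cmod_ge0.
  rewrite -EFinD -EFinM lee_fin /Q -(mulrDr (weight3 l x)) (mulrCA 8)
    ler_wpM2l //.
  rewrite -[4%N]/(2 * 2)%N exprM.
  have c2 : 0 <= cmod (fourier3 F x) ^+ 2 by exact: sqr_ge0.
  have := cmod_le x; set u := _ ^+ 2 + _; set v := _ ^+ 2 + _ => cuv.
  have : (cmod (fourier3 F x) ^+ 2) ^+ 2 <= (2 * (u + v)) ^+ 2.
    by rewrite ler_pXn2r // nnegrE // (le_trans c2).
  have := sqr_ge0 (u - v); lra.
rewrite ge0_integralZl//; last 2 first.
- by apply: emeasurable_funD.
- by move=> x _; rewrite adde_ge0.
rewrite ge0_integralD//.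
apply: (@le_trans _ _ (8%:E * ((256 * e ^+ 2 * ln ((e + 4) / e) * q1 ^+ 2)%:E +
  (256 * e ^+ 2 * ln ((e + 4) / e) * q2 ^+ 2)%:E))%E).
  by apply: lee_wpmul2l => //; exact: leeD.
rewrite -EFinD -EFinM lee_fin; move: (ln _) ln0 => L L0.
rewrite (_ : 8 * _ = 2048 * e ^+ 2 * L * (q1 ^+ 2 + q2 ^+ 2)); last ring.
apply: ler_wpM2l.
  by apply: mulr_ge0; [apply: mulr_ge0;
    [exact: ler0n|exact: sqr_ge0]|exact: L0].
rewrite -[4%N]/(2 * 2)%N exprM.
have : (q1 + q2) ^+ 2 <= (n ^+ 2) ^+ 2.
  by rewrite ler_pXn2r // ?nnegrE ?addr_ge0 // sqr_ge0.
have : 0 <= q1 * q2 by rewrite mulr_ge0.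
lra.
Qed.

End complex_function.

(** * Interpolation and conclusion *)

Section interpolation.
Context d (T : measurableType d) {R : realType}
  (mu : {measure set T -> \bar R}).
Variables (g w : T -> R) (B : set T) (X K : R).
Hypotheses (g0 : forall x, 0 <= g x) (gX : forall x, g x <= X) (K1 : 1 <= K).
Hypotheses (w0 : forall x, 0 <= w x) (w1 : forall x, B x -> 1 <= w x).
Hypotheses (mwg : measurable_fun setT (fun x => w x * g x ^+ 4))
  (L4 : (\int[mu]_x (w x * g x ^+ 4)%:E <= (K * X ^+ 4)%:E)%E) (X0 : 0 <= X).

(** For finite p this is g^p <= X^(p - 4) g^4. The weight w, which is at least
    1 on B, stands for the indicator of B. *)
Lemma Lnorm_interpolation (p : \bar R) : (4%:E <= p)%E ->
  ('N[mu]_p[(fun x => (g x)%:E) \_ B] <= (K * X)%:E)%E.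
Proof.
have K0 : 0 <= K by rewrite (le_trans ler01).
case: p => [p| |] //; last first.
  move=> _; rewrite unlock /=; case: ifPn => _;
    last by rewrite lee_fin mulr_ge0.
  apply/ess_supP; apply: aeW => x /=.
  rewrite patchE; case: ifP => _;
    last by rewrite (_ : point = 0%E) // abse0 lee_fin mulr_ge0.
  rewrite /= lee_fin ger0_norm // (le_trans (gX x)) // ler_peMl //.
rewrite lee_fin => p4.
have p0 : 0 < p by rewrite (lt_le_trans _ p4).
have pn0 : p != 0 by rewrite gt_eqF.
rewrite unlock.
have main : (\int[mu]_x (`|((fun x => (g x)%:E) \_ B) x| `^ p) <=
    (X `^ (p - 4) * (K * X ^+ 4))%:E)%E.
  apply: (@le_trans _ _ (\int[mu]_x
    ((X `^ (p - 4))%:E * (w x * g x ^+ 4)%:E))%E); last first.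
    rewrite ge0_integralZl//; last 3 first.
    - exact: measurable_EFin_comp.
    - by move=> x _; rewrite lee_fin mulr_ge0 // exprn_ge0.
    - by rewrite lee_fin powR_ge0.
    by rewrite EFinM; apply: lee_wpmul2l => //; rewrite lee_fin powR_ge0.
  apply: ge0_le_integral_pointwise => x; first exact: poweR_ge0.
  rewrite -EFinM patchE; case: ifPn => [/set_mem xB|_]; last first.
    rewrite (_ : point = 0%E) // abse0 poweR0r // lee_fin; apply: mulr_ge0;
      first exact: powR_ge0.
    by apply: mulr_ge0 => //; exact: exprn_ge0.
  rewrite /= lee_fin (ger0_norm (g0 x)).
  have [->|gn0] := eqVneq (g x) 0.
    rewrite powR0 //; apply: mulr_ge0; first exact: powR_ge0.
    by apply: mulr_ge0 => //; exact: exprn_ge0.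
  have -> : g x `^ p = g x `^ (p - 4) * g x ^+ 4.
    by rewrite -powR_mulrn // -powRD ?subrK // gn0 implybT.
  apply: ler_pM; rewrite ?powR_ge0 ?exprn_ge0 //.
    by apply: ge0_ler_powR; rewrite ?nnegrE // subr_ge0.
  by rewrite ler_peMl ?exprn_ge0 // w1.
apply: (@le_trans _ _ ((X `^ (p - 4) * (K * X ^+ 4))%:E `^ p^-1)%E).
  apply: gt0_ler_poweR => //.
  - by rewrite invr_ge0 ltW.
  - by rewrite in_itv /= leey andbT; apply: integral_ge0 => x _;
    exact: poweR_ge0.
  - rewrite in_itv /= leey andbT lee_fin; apply: mulr_ge0;
    first exact: powR_ge0.
    by apply: mulr_ge0 => //; exact: exprn_ge0.
rewrite poweR_EFin lee_fin.
(* For X = 0 and p = 4 the factor X^(p - 4) is 0^0 = 1. *)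
have [->|Xn0] := eqVneq X 0.
  by rewrite expr0n /= !mulr0 powR0 // invr_neq0.
have -> : X `^ (p - 4) * (K * X ^+ 4) = K * X `^ p.
  by rewrite mulrCA -powR_mulrn // -powRD ?subrK // Xn0 implybT.
rewrite powRM ?powR_ge0 // -powRrM mulfV // powRr1 // ler_wpM2r //.
apply: ler1_powR => //; rewrite invf_le1 //; lra.
Qed.

End interpolation.

(** This is ln z <= z at z = ((e + 4) / e)^eps. *)
Lemma ln_ratio_le (R : realType) (e eps : R) : 0 < e < 1 -> 0 < eps ->
  ln ((e + 4) / e) <= 5 `^ eps / eps * e `^ (- eps).
Proof.
move=> /andP[e0 e1] eps0.
have y0 : 0 < (e + 4) / e by rewrite divr_gt0 // ltr_wpDl // ltW.
have h : eps * ln ((e + 4) / e) <= ((e + 4) / e) `^ eps.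
  by rewrite -ln_powR; apply: ltW; apply: ln_sublinear; rewrite powR_gt0.
rewrite mulrAC ler_pdivlMr // mulrC; apply: le_trans h _.
have ei0 : 0 <= e^-1 by rewrite invr_ge0 ltW.
rewrite -mulN1r powRrM (powR_inv1 (ltW e0)) -powRM //.
apply: ge0_ler_powR; first exact: ltW.
- by rewrite nnegrE ltW.
- by rewrite nnegrE mulr_ge0.
by rewrite ler_pM2r ?invr_gt0 //; lra.
Qed.

(** The bounds [fourier3_sup] and [fourier3_L4] match, with X = 23 e^(1/2) n,
    since X^4 is a multiple of e^2 n^4. *)
Theorem stein_tomas (R : realType) : stein_tomas_estimate R.
Proof.
move=> p p4 eps eps0.
(* The factor exp 3 compensates the lower bound exp (- 3) of the weight on the
   ball; the summand 1 makes K0 e^(- eps) at least 1, as the interpolation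
   requires. *)
pose K0 : R := expR 3 * 2048 / 23 ^+ 4 * (5 `^ eps / eps) + 1.
have A0 : 0 <= expR 3 * 2048 / 23 ^+ 4 * (5 `^ eps / eps) :> R.
  apply: mulr_ge0; last by rewrite divr_ge0 ?powR_ge0 // ltW.
  apply: mulr_ge0; last by rewrite invr_ge0 exprn_ge0.
  apply: mulr_ge0; [exact: expR_ge0|exact: ler0n].
exists (23 * K0); first by rewrite mulr_gt0 // ltr_wpDl.
move=> e e01 c F N LF F0; have /andP[e0 e1] := e01.
set n := fine (cLnorm (leb3 R) 2%:E N F).
have N0 : (0 <= cLnorm (leb3 R) 2%:E N F)%E by exact: Lnorm_ge0.
have n0 : 0 <= n by exact: fine_ge0.
have -> : cLnorm (leb3 R) 2%:E N F = n%:E.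
  by rewrite /n fineK // ge0_fin_numE //; case: LF.
have [l l0 lB] := ball3_weight c e^-1.
pose X := 23 * e `^ 2^-1 * n.
have X0 : 0 <= X by rewrite !mulr_ge0 ?powR_ge0.
have ee1 : 1 <= e `^ (- eps).
  rewrite powRN -[leLHS]invr1 lef_pV2 ?posrE ?powR_gt0 //.
  by rewrite -(powRr0 e) ger_powR // ?e0 ?ltW.
rewrite -EFinM (_ : 23 * K0 * e `^ (- eps) * e `^ 2^-1 * n =
  (K0 * e `^ (- eps)) * X); last first.
  by rewrite /X; ring.
rewrite /cLnorm.
apply: (@Lnorm_interpolation _ _ _ (leb3 R) (fun x => cmod (fourier3 F x))
  (fun x => expR 3 * weight3 l x)) => //.
- by move=> x; exact: cmod_ge0.
- exact: fourier3_sup.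
- by rewrite -[leLHS]mulr1 ler_pM // /K0 lerDr.
- by move=> x; rewrite mulr_ge0 ?expR_ge0 ?weight3_ge0.
- move=> x /lB h; apply: (@le_trans _ _ (expR 3 * expR (- 3)));
  first by rewrite expRxMexpNx_1.
  by rewrite /= ler_pM2l ?expR_gt0.
- have := measurable_cmod_fourier3 e01 LF F0;
  have := measurable_weight3 l => *; measurability.
under eq_integral do rewrite -mulrA EFinM.
rewrite ge0_integralZl//; last 2 first.
- have := measurable_cmod_fourier3 e01 LF F0;
  have := measurable_weight3 l => *; measurability.
- by move=> x _; rewrite lee_fin mulr_ge0 ?weight3_ge0 // exprn_ge0 // cmod_ge0.
apply: le_trans (lee_wpmul2l _ (fourier3_L4 e01 LF F0 l0)) _;
  first by rewrite lee_fin expR_ge0.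
rewrite -EFinM lee_fin.
have X4 : X ^+ 4 = 23 ^+ 4 * (e ^+ 2 * n ^+ 4).
  rewrite /X !exprMn -mulrA; congr (_ * (_ * _)).
  by rewrite -[4%N]/(2 * 2)%N exprM -[(e `^ _) ^+ 2]powR_mulrn ?powR_ge0 //
    -powRrM mulVf ?pnatr_eq0 // (powRr1 (ltW e0)).
rewrite X4 -/n.
have L := ln_ratio_le e01 eps0.
move: L A0; rewrite /K0; set A := 5 `^ eps / eps; set E := e `^ (- eps) => L A0.
have Z0 : 0 <= e ^+ 2 * n ^+ 4 by apply: mulr_ge0;
  [exact: sqr_ge0|exact: exprn_ge0].
move: (e ^+ 2) (n ^+ 4) (ln _) Z0 L => Z1 Z2 Ln Z0 L.
apply: (@le_trans _ _ (expR 3 * 2048 * (Z1 * Z2) * (A * E))).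
  rewrite (_ : expR 3 * (2048 * Z1 * Ln * Z2) = expR 3 * 2048 * (Z1 * Z2)
    * Ln); last ring.
  apply: ler_wpM2l; last exact: L.
  apply: mulr_ge0; last exact: Z0.
  by apply: mulr_ge0; [exact: expR_ge0|exact: ler0n].
have : 0 < 23 ^+ 4 :> R by rewrite exprn_gt0.
move: (23 ^+ 4) => B B0.
rewrite (_ : (expR 3 * 2048 / B * A + 1) * E * (B * (Z1 * Z2)) =
  expR 3 * 2048 * (Z1 * Z2) * (A * E) + E * (B * (Z1 * Z2))); last first.
  by field; rewrite gt_eqF.
rewrite lerDl; apply: mulr_ge0; first exact: powR_ge0.
by apply: mulr_ge0; [exact: ltW|exact: Z0].
Qed.

Theorem proposition1p10 (R : realType)
    (Rc : R -> R -> set (R * R)) (Xi : R -> R -> R * R -> R * R -> R[i])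
    (hRc : forall a b : R, 0 < a -> 0 < b -> rect_collection a b (Rc a b))
    (hXi : forall a b : R, 0 < a -> 0 < b ->
       partition_family a b (Rc a b) (Xi a b)) :
  decoupling_inequality Rc Xi -> stein_tomas_estimate R.
Proof. by move=> _; exact: stein_tomas. Qed.
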